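(* Let $\lambda,\mu>0$, $\rho=\lambda/\mu$, and (for $\rho\le e^{-1}$) let $H$ be the stationary height of the birth and death random tree process with parameters $\lambda,\mu$, i.e. $H=\lim_{t\to\infty}H(t)$ in distribution. Let $r\le1$ be the smallest root of $re^{-r}=\rho$. 1. For $\rho\le e^{-1}$, the following relations hold: \[ \mathsf{P}\{H=0\}=e^{-r},\qquad \mathsf{P}\{H>h+1\}=1-\exp\bigl[-r\,\mathsf{P}\{H>h\}\bigr],\quad \forall h\ge0\ (h\text{ integer}). \] 2. If $\rho<e^{-1}$, then there exists a positive constant $\theta(r,1)$ such that \[ \mathsf{P}\{H>h\}=\theta(r,1)\,r^{h+1}+O\Bigl(\frac{r^{2h}}{1-r}\Bigr), \] where the function $\theta(r,x)$ is the solution, locally analytic with respect to $x$, of the functional Schröder equation \[ \theta(r,1-e^{-rx})=r\,\theta(r,x), \] subject to the boundary condition $\dfrac{\partial\theta}{\partial x}(r,0)=1$. 3. When $\rho=e^{-1}$, \[ \mathsf{P}\{H>h\}=\frac2h+O\Bigl(\frac{\log h}{h^2}\Bigr)\quad (h\to\infty). \]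
   Context: The process $G=\{G(t),t\ge0\}$ is a continuous-time Markov chain whose state space is the set of finite directed trees rooted at a fixed vertex $v_0$. At time $0$, $G(0)$ consists of the single vertex $v_0$. Transitions: (adjunction) at each vertex $v$ of the current tree, independently, a new edge with origin $v$ and ending at a new leaf is appended at the epochs of a Poisson process of rate $\lambda>0$; (deletion) each vertex other than the root, as long as it is a leaf (has no descendant), is deleted at rate $\mu$. The root is never deleted. The process is ergodic (positive recurrent) when $\rho=\lambda/\mu\le e^{-1}$. $H(t)$ is the height of $G(t)$, i.e. the maximal distance (number of edges) from the root to a vertex of $G(t)$. In the Schröder equation $x$ ranges over the nonnegative reals. *)

(* Defs.v *)
From HB Require Import structures.
From mathcomp Require Import all_boot all_order all_algebra.
From mathcomp Require Import all_classical all_reals all_analysis.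

Set Implicit Arguments.
Unset Strict Implicit.
Unset Printing Implicit Defensive.
Import Order.TTheory GRing.Theory Num.Theory.
Import numFieldNormedType.Exports.
Local Open Scope classical_set_scope.
Local Open Scope ring_scope.

(* A finite rooted tree is given by the list of the subtrees of its root.  In
   the process below the children of a vertex are listed in order of birth, so
   that the order carries no randomness of its own. *)
Inductive tree := Node of seq tree.

Definition single_vertex : tree := Node [::].

Fixpoint tree_encode (t : tree) : GenTree.tree unit :=
  let: Node cs := t in GenTree.Node 0 (map tree_encode cs).

Fixpoint tree_decode (g : GenTree.tree unit) : tree :=
  match g with
  | GenTree.Leaf _ => single_vertex
  | GenTree.Node _ gs => Node (map tree_decode gs)
  end.

Lemma tree_encodeK : cancel tree_encode tree_decode.
Proof.
rewrite /cancel; fix IH 1 => -[cs] /=; congr Node.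
by elim: cs => //= c cs ->; rewrite IH.
Qed.

HB.instance Definition _ := CanIsCountable tree_encodeK.

Fixpoint height (t : tree) : nat :=
  let: Node cs := t in foldr (fun c m => maxn (height c).+1 m) 0%N cs.

(* The trees obtained from [t] by appending a new leaf at a vertex of [t]: one
   entry per vertex, so that the list records multiplicities. *)
Fixpoint adjunctions (t : tree) : seq tree :=
  let: Node cs := t in
  Node (rcons cs single_vertex) ::
  map Node
    ((fix aux (cs : seq tree) : seq (seq tree) :=
      if cs is c :: cs' then
        [seq c' :: cs' | c' <- adjunctions c] ++ [seq c :: s | s <- aux cs']
      else [::]) cs).

(* The trees obtained from [t] by deleting a leaf other than the root: one entry
   per such leaf.  Equal subtrees of siblings give repeated entries. *)
Fixpoint deletions (t : tree) : seq tree :=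
  let: Node cs := t in
  map Node
    ((fix aux (cs : seq tree) : seq (seq tree) :=
      if cs is c :: cs' then
        (if c is Node [::] then [:: cs']
         else [seq c' :: cs' | c' <- deletions c]) ++ [seq c :: s | s <- aux cs']
      else [::]) cs).

Section MarkovChain.
Context {R : realType} {S : choiceType}.

Definition transition_function (p : R -> S -> S -> R) : Prop :=
  [/\ forall t x y, 0 <= t -> 0 <= p t x y,
      forall t x, 0 <= t -> (\esum_(y in [set: S]) (p t x y)%:E = 1)%E,
      forall x y, p 0 x y = (x == y)%:R
    & forall s t x z, 0 <= s -> 0 <= t ->
        ((p (s + t) x z)%:E = \esum_(y in [set: S]) (p s x y * p t y z)%:E)%E].

Definition has_rates (p : R -> S -> S -> R) (q : S -> S -> R) : Prop :=
  forall x y, t^-1 * (p t x y - (x == y)%:R) @[t --> 0^'+] --> q x y.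

(* [G t], for [0 <= t], is the state at time [t]; in the Markov property
   [t 0 <= ... <= t n] are the past and present times and [t n.+1] is a future
   time. *)
Definition markov_process d (T : measurableType d) (P : probability T R)
    (G : R -> T -> S) (p : R -> S -> S -> R) (x0 : S) : Prop :=
  [/\ forall t x, 0 <= t -> measurable [set w | G t w = x],
      P [set w | G 0 w = x0] = 1%E
    & forall (n : nat) (t : nat -> R) (x : nat -> S),
        0 <= t 0%N -> {homo t : i j / (i <= j)%N >-> i <= j} ->
        P [set w | forall i, (i <= n.+1)%N -> G (t i) w = x i] =
        (P [set w | forall i, (i <= n)%N -> G (t i) w = x i] *
         (p (t n.+1 - t n) (x n) (x n.+1))%:E)%E].

Definition continuous_time_markov_chain d (T : measurableType d)
    (P : probability T R) (G : R -> T -> S) (q : S -> S -> R) (x0 : S) : Prop :=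
  exists p, [/\ transition_function p, has_rates p q
              & markov_process P G p x0].

End MarkovChain.

(* No tree is obtained from itself by an adjunction or a deletion, so the last
   two terms are the diagonal of the rate matrix. *)
Definition tree_rate {R : realType} (lambda mu : R) (x y : tree) : R :=
  lambda * (count_mem y (adjunctions x))%:R
  + mu * (count_mem y (deletions x))%:R
  - (x == y)%:R * (lambda * (size (adjunctions x))%:R
                   + mu * (size (deletions x))%:R).

Definition birth_death_tree_process {R : realType} d (T : measurableType d)
    (P : probability T R) (lambda mu : R) (G : R -> T -> tree) : Prop :=
  continuous_time_markov_chain P G (tree_rate lambda mu) single_vertex.

(* [H] is the limit in distribution of the height of [G t].  For random variables
   with values in [nat], this is convergence of the probabilities of points. *)
Definition stationary_height {R : realType} d (T : measurableType d)
    (P : probability T R) (G : R -> T -> tree)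
    d' (T' : measurableType d') (P' : probability T' R) (H : T' -> nat) : Prop :=
  (forall h, measurable [set w | H w = h]) /\
  (forall h, P [set w | height (G t w) = h] @[t --> +oo%R]
               --> P' [set w | H w = h]).

Definition smallest_root {R : realType} (rho r : R) : Prop :=
  [/\ r <= 1, r * expR (- r) = rho
    & forall s, s * expR (- s) = rho -> r <= s].

Section Schroeder.
Context {R : realType}.

Definition analytic_on_nonneg (f : R -> R) : Prop :=
  forall x0, 0 <= x0 ->
    exists (a : nat -> R) (e : R), 0 < e /\
      forall x, 0 <= x -> `|x - x0| < e -> pseries a (x - x0) @ \oo --> f x.

(* The domain is [x >= 0], hence the derivative at [0] is one-sided. *)
Definition schroeder_solution (r : R) (f : R -> R) : Prop :=
  [/\ forall x, 0 <= x -> f (1 - expR (- (r * x))) = r * f x,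
      analytic_on_nonneg f
    & x^-1 * (f x - f 0) @[x --> 0^'+] --> (1 : R)].

End Schroeder.

(* Main.v *)
Require Import Defs.
From mathcomp Require Import all_boot all_order all_algebra.
From mathcomp Require Import all_classical all_reals all_analysis.
From mathcomp Require Import ring lra zify.
Import Order.TTheory GRing.Theory Num.Theory.
Import numFieldNormedType.Exports.
Local Open Scope classical_set_scope.
Local Open Scope ring_scope.

(* Let [z_h t] be the probability that a subtree born as a single vertex is, at
   age [t], still alive and of height at least [h].  A non-explosion estimate
   gives uniqueness for the backward equation; it implies that the subtrees of
   the root evolve independently, so that [V_h t], the probability that the
   height is at most [h] at time [t], satisfies [V_h' = - lambda V_h z_h].  The
   subtrees evolve like the whole tree until they are deleted, at rate [mu] from
   the single vertex; in Laplace transforms this reads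
   [lap z_h * (1 + mu * lap V_0) = lap (1 - V_(h-1))].  For [h = 0] it shows that
   [x = lambda * lap z_0] never satisfies [x e^(-x) = rho], hence stays below
   [r].  Letting the Laplace variable tend to [0] gives [V_0 = e^(-r)] and
   [V_(h+1) = exp (- r (1 - V_h))] for the limits in [t].  The tails are thus the
   iterates at [1] of [x |-> 1 - e^(-rx)]; [theta r] is the Koenigs function of
   this map at [0], analytic because the iterates converge geometrically in a
   weighted l^1 norm of Taylor coefficients.  In the critical case the
   reciprocals of the iterates increase by [1/2 + O(1/h)]. *)

(** * One-sided calculus on the half-line *)

(** The rates grow with the tree, and the transition function is known only through its derivative
    at time [0], so that no jump construction and no forward equation is at hand. What can be
    derived is the backward equation, and its bounded solutions are unique because a jump raises the
    size by at most one while the rates are linear in the size. Every probabilistic statement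
    (independence of the subtrees, renewal after a deletion) is therefore phrased as an identity
    between bounded functions that solve the same backward or resolvent equation. In the renewal
    equation only the Abelian direction is needed, since convergence in [t] is part of the
    hypothesis on [H]. The limit alone gives [s * expR (- s) = rho] for [s = lambda / (mu * l 0)],
    which has two positive roots when [rho < expR (- 1)]; the inequality [x * expR (- x) < rho],
    strict for each positive Laplace variable, is what selects the smaller one. *)

Section DerivativeOnNonneg.
Context {R : realType}.
Implicit Types (u v g k : R -> R) (t : R).

(** Functions of time carry no information at negative times, hence mere continuity from the right
    at [0]. *)
Definition der0 u g : Prop :=
  (forall t, 0 < t -> is_derive t 1 u (g t)) /\ u t @[t --> 0^'+] --> u 0.

Lemma is_derive_continuous u t (d : R) : is_derive t 1 u d -> {for t, continuous u}.
Proof. by move=> [/derivable1_diffP/differentiable_continuous]. Qed.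

Lemma der0_ext u g k : der0 u g -> (forall t, 0 < t -> g t = k t) -> der0 u k.
Proof. by move=> [ug u0] gk; split=> // t t0; rewrite -gk//; exact: ug. Qed.

Lemma der0_eq u v g : der0 u g -> (forall t, u t = v t) -> der0 v g.
Proof. by move=> ug /funext <-. Qed.

Lemma der0_cst (c : R) : der0 (fun=> c) (fun=> 0).
Proof. by split=> [t t0|]; [exact: is_derive_cst|exact: cvg_cst]. Qed.

Lemma der0D u v g k : der0 u g -> der0 v k ->
  der0 (fun t => u t + v t) (fun t => g t + k t).
Proof.
move=> [ug u0] [vk v0]; split=> [t t0|]; last exact: cvgD.
have := ug _ t0; have := vk _ t0 => *; exact: is_deriveD.
Qed.

Lemma der0M u v g k : der0 u g -> der0 v k ->
  der0 (fun t => u t * v t) (fun t => g t * v t + u t * k t).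
Proof.
move=> [ug u0] [vk v0]; split=> [t t0|]; last exact: cvgM.
have := ug _ t0; have := vk _ t0 => *.
by apply: is_derive_eq; rewrite /GRing.scale/= addrC [v t * _]mulrC.
Qed.

Lemma der0Z (c : R) u g : der0 u g -> der0 (fun t => c * u t) (fun t => c * g t).
Proof.
move=> ug; apply: der0_ext (der0M _ _ _ _ (der0_cst c) ug) _ => t _ /=.
by rewrite mul0r add0r.
Qed.

Lemma der0N u g : der0 u g -> der0 (fun t => - u t) (fun t => - g t).
Proof.
move=> /(der0Z (-1)) /der0_eq h; apply: der0_ext (h _ _) _ => t; by rewrite mulN1r.
Qed.

Lemma der0B u v g k : der0 u g -> der0 v k ->
  der0 (fun t => u t - v t) (fun t => g t - k t).
Proof. by move=> ug /der0N; exact: der0D. Qed.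

Lemma der0V u g : (forall t, 0 <= t -> u t != 0) -> der0 u g ->
  der0 (fun t => (u t)^-1) (fun t => - g t / u t ^+ 2).
Proof.
move=> un0 [ug u0]; split=> [t t0|]; last by apply: cvgV => //; exact: un0.
have := ug _ t0 => ?; have ut0 := un0 _ (ltW t0).
by apply: is_derive_eq; rewrite /GRing.scale/= mulrC mulrN mulNr.
Qed.

Lemma der0_expR (c : R) : der0 (fun t => expR (c * t)) (fun t => c * expR (c * t)).
Proof.
have d t : is_derive t (1 : R) (fun t => expR (c * t)) (c * expR (c * t)).
  have h : is_derive t (1 : R) ( *%R c) c.
    by apply: is_derive_eq; rewrite /GRing.scale /= mulr1.
  by apply: is_derive_eq; rewrite /GRing.scale /= mulrC.
split=> [t _ //|]; apply: cvg_at_right_filter.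
apply: is_derive_continuous (d 0).
Qed.

Lemma der0_cont u g t : der0 u g -> 0 < t -> {for t, continuous u}.
Proof.
move=> [ug _] t0; exact: is_derive_continuous (ug _ t0).
Qed.

Lemma der0_nondecreasing u g (T : R) : der0 u g ->
  (forall t, 0 < t -> t < T -> 0 <= g t) ->
  forall s t, 0 <= s -> s <= t -> t <= T -> u s <= u t.
Proof.
move=> [ug u0] g0 s t s0; rewrite le_eqVlt => /predU1P[->//|st] tT.
have [||c cst] := @MVT _ u g s t st.
- by move=> x /[!in_itv]/= /andP[sx _]; apply: ug; exact: le_lt_trans sx.
- apply/(continuous_within_itvP _ st); split.
  + move=> x /[!in_itv]/= /andP[sx _]; apply: (der0_cont _ _ _ (conj ug u0)).
    exact: le_lt_trans sx.
  + move: s0; rewrite le_eqVlt => /predU1P[<-//|s0].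
    apply: cvg_at_right_filter; exact: (der0_cont _ _ _ (conj ug u0)).
  + apply: cvg_at_left_filter; apply: (der0_cont _ _ _ (conj ug u0)).
    exact: le_lt_trans st.
- move=> e; rewrite -subr_ge0 e; apply: mulr_ge0; last by rewrite subr_ge0 ltW.
  move: cst; rewrite in_itv/= => /andP[sc ct].
  by apply: g0; [exact: le_lt_trans sc|exact: lt_le_trans tT].
Qed.

(** The error is uniform in the base point, so an increment over a length [s] is at most
    [s * (M + eta s)]; this gives continuity from the left as well. It precedes differentiability
    because the derivative of a semigroup is a combination of semigroup values, whose continuity
    must be known first. *)
Lemma der0_of_right_quotient u g (eta : R -> R) (M : R) :
  eta s @[s --> 0^'+] --> (0 : R) ->
  (forall t s, 0 <= t -> 0 < s -> `|s^-1 * (u (t + s) - u t) - g t| <= eta s) ->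
  (forall t, 0 <= t -> `|g t| <= M) ->
  (forall t, 0 < t -> {for t, continuous u}) /\ u t @[t --> 0^'+] --> u 0.
Proof.
move=> eta0 ug gM.
have M0 : 0 <= M by apply: le_trans (gM _ (lexx _)).
have lip t s : 0 <= t -> 0 < s -> `|u (t + s) - u t| <= s * (M + eta s).
  move=> t0 s0; have -> : u (t + s) - u t = s * (s^-1 * (u (t + s) - u t)).
    by rewrite mulrA mulfV ?mul1r // gt_eqF.
  rewrite normrM (gtr0_norm s0) ler_pM2l//.
  have -> : s^-1 * (u (t + s) - u t) = g t + (s^-1 * (u (t + s) - u t) - g t).
    by ring.
  by apply: le_trans (ler_normD _ _) _; apply: lerD; [exact: gM|exact: ug].
have lim0 : s * (M + eta s) @[s --> 0^'+] --> (0 : R).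
  rewrite -[X in _ --> X](mul0r (M + 0)); apply: cvgM.
    exact: cvg_at_right_filter.
  by apply: cvgD => //; exact: cvg_cst.
have key (e : R) : 0 < e -> exists2 d : R, 0 < d &
    forall t s, 0 <= t -> 0 <= s -> s < d -> `|u (t + s) - u t| < e.
  move=> e0; have /cvgrPdist_lt /(_ e e0) := lim0.
  rewrite near_withinE => -[d /= d0 hd]; exists d => // t s t0.
  rewrite le_eqVlt => /predU1P[<-|s0] sd; first by rewrite addr0 subrr normr0.
  apply: le_lt_trans (lip _ _ t0 s0) _.
  have := hd s _ s0; rewrite /= sub0r normrN (gtr0_norm s0) sub0r normrN => /(_ sd).
  exact: le_lt_trans (ler_norm _).
split=> [t t0|].
  apply/cvgrPdist_lt => e /key[d d0 hd]; near=> s.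
  have sd : `|t - s| < d by near: s; exists d.
  have s0 : 0 < s by near: s; exact: lt_nbhsr.
  have [ts|/ltW st] := leP t s.
    rewrite distrC -[s](subrK t) [s - t + t]addrC; apply: hd; rewrite ?(ltW t0) ?subr_ge0//.
    by move: sd; rewrite distrC ger0_norm// subr_ge0.
  rewrite -{1}[t](subrK s) [t - s + s]addrC; apply: hd; rewrite ?(ltW s0) ?subr_ge0//.
  by move: sd; rewrite ger0_norm// subr_ge0.
apply/cvgrPdist_lt => e /key[d d0 hd]; near=> s.
rewrite distrC -[s]add0r; apply: hd => //.
Unshelve. all: by end_near. Qed.

(* The error bound is uniform in [t], so that it also controls the left
   difference quotient. *)
Lemma der0_of_right_quotient_cont u g (eta : R -> R) :
  eta s @[s --> 0^'+] --> (0 : R) ->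
  (forall t s, 0 <= t -> 0 < s -> `|s^-1 * (u (t + s) - u t) - g t| <= eta s) ->
  (forall t, 0 < t -> {for t, continuous g}) ->
  forall t, 0 < t -> is_derive t 1 u (g t).
Proof.
move=> eta0 ug gc t t0.
suff h : (fun s => s^-1 *: ((u \o shift t) (s *: 1) - u t)) @ 0^' --> (g t : R).
  by apply: DeriveDef; [apply/cvg_ex; exists (g t)|exact: cvg_lim].
apply/cvgrPdist_lt => e e0.
have e20 : 0 < e / 2 by rewrite divr_gt0.
have /cvgrPdist_lt /(_ _ e20) := eta0; rewrite near_withinE => -[d /= d0 hd].
have /cvgrPdist_lt /(_ _ e20) [d1 /= d10 hd1] := gc _ t0.
have etaP s : 0 < s -> s < d -> eta s < e / 2.
  move=> s0 sd; have := hd s; rewrite /= !sub0r !normrN (gtr0_norm s0) => /(_ sd s0).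
  exact: le_lt_trans (ler_norm _).
rewrite near_withinE.
exists (Num.min d (Num.min d1 t)) => [|s /=]; first by rewrite /= !lt_min d0 d10 t0.
rewrite sub0r normrN !lt_min => /and3P[sd sd1 st] sn0.
rewrite /GRing.scale/= mulr1.
have [s0|s0] := ltP 0 s.
  rewrite distrC [s + t]addrC; apply: le_lt_trans (ug _ _ (ltW t0) s0) _.
  apply: lt_trans (etaP _ s0 _) _; first by rewrite -(gtr0_norm s0).
  by rewrite ltr_pdivrMr// mulr_natr mulr2n ltrDl.
have {s0}s0 : s < 0 by rewrite lt_neqAle sn0.
rewrite (ltr0_norm s0) in sd sd1 st.
have ts0 : 0 < t + s by rewrite -ltrBlDr sub0r.
have Ns0 : 0 < - s by rewrite oppr_gt0.
have := ug _ _ (ltW ts0) Ns0; rewrite addrK.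
rewrite invrN mulNr -mulrN opprB [t + s]addrC => h1.
have h2 : `|g t - g (s + t)| < e / 2.
  by apply: hd1; rewrite /ball_/= opprD addrCA subrr addr0 normrN ltr0_norm.
rewrite (splitr e); have -> : g t - s^-1 * (u (s + t) - u t) =
  (g t - g (s + t)) - (s^-1 * (u (s + t) - u t) - g (s + t)).
  by ring.
apply: le_lt_trans (ler_normB _ _) _; apply: ltrD => //.
exact: le_lt_trans h1 (etaP _ Ns0 sd).
Qed.

Lemma der0_antiderivative u : (forall t, 0 < t -> {for t, continuous u}) ->
  u t @[t --> 0^'+] --> u 0 -> exists2 A, A 0 = 0 & der0 A u.
Proof.
(* The constant extension is continuous on the whole line, so that the fundamental theorem of
   calculus applies on intervals starting at [-1], with [0] in their interior. *)
move=> uc u0; pose v t := u (Num.max t 0).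
have vc (t : R) : v x @[x --> t] --> v t.
  have [t0|t0|->] := ltgtP t 0.
  - apply: (@cvg_trans _ ((fun _ : R => u 0) @ nbhs t)).
      apply: near_eq_cvg; near=> s; rewrite /v max_r//; apply: ltW.
      by near: s; exact: lt_nbhsl.
    by rewrite /v (max_r (ltW t0)); exact: cvg_cst.
  - apply: (@cvg_trans _ (u @ t)).
      apply: near_eq_cvg; near=> s; rewrite /v max_l//; apply: ltW.
      by near: s; exact: lt_nbhsr.
    by rewrite /v (max_l (ltW t0)); exact: uc.
  - apply/left_right_continuousP; rewrite /v maxxx; split.
      apply: (@cvg_trans _ ((fun=> u 0) @ 0^'-)); last exact: cvg_cst.
      by apply: near_eq_cvg; near=> s; rewrite /v max_r//.
    apply: (@cvg_trans _ (u @ 0^'+)) => //.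
    by apply: near_eq_cvg; near=> s; rewrite /v max_l//.
pose F (x : R) : R := \int[lebesgue_measure]_(t in [set` `[-1, x]]) v t.
have dF (x : R) : -1 < x -> is_derive x 1 F (v x).
  move=> x1; have xu : x < x + 1 by rewrite ltrDl.
  have iv : lebesgue_measure.-integrable `[-1, x + 1] (EFin \o v).
    apply: continuous_compact_integrable; first exact: segment_compact.
    exact: continuous_subspaceT.
  have [] := @continuous_FTC1_closed _ v (-1) x _ xu iv x1 (vc x).
  by move=> dF eF; apply: DeriveDef => //; rewrite -derive1E.
exists (fun t => F t - F 0); first by rewrite subrr.
have h (t : R) : 0 <= t -> is_derive t (1 : R) (fun t => F t - F 0) (u t).
  move=> t0; have ? : is_derive t 1 F (v t).
    by apply: dF; apply: lt_le_trans t0; rewrite ltrN10.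
  by apply: is_derive_eq; rewrite subr0 /v max_l.
split=> [t /ltW/h//|].
apply: cvg_at_right_filter; exact: is_derive_continuous (h 0 (lexx _)).
Unshelve. all: by end_near. Qed.

End DerivativeOnNonneg.

(** * A maximum principle with linearly growing rates *)

Section MaximumPrinciple.
Context {R : realType}.

Lemma der0_shift (u g : R -> R) (a : R) : 0 <= a -> der0 u g ->
  der0 (fun t => u (a + t)) (fun t => g (a + t)).
Proof.
rewrite le_eqVlt => /predU1P[<-|a0] ug.
  by under eq_fun do rewrite add0r; apply: der0_ext ug _ => t _; rewrite add0r.
have d (t : R) : 0 <= t -> is_derive t (1 : R) (fun t => u (a + t)) (g (a + t)).
  move=> t0; have [/(_ (a + t)) h _] := ug.
  have {}h := h (ltr_wpDr t0 a0).
  have h2 : is_derive t (1 : R) (fun t => a + t) 1.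
    have /= := is_deriveD (is_derive_cst a t 1) (is_derive_id t (1 : R)).
    by rewrite add0r.
  by have /= := is_derive1_comp h h2; rewrite mulr1.
split=> [t /ltW/d//|].
apply: cvg_at_right_filter; exact: is_derive_continuous (d 0 (lexx _)).
Qed.

Lemma der0_exprn (n : nat) : der0 (fun t : R => t ^+ n.+1) (fun t => n.+1%:R * t ^+ n).
Proof.
have h (t : R) : is_derive t (1 : R) (fun t => t ^+ n.+1) (n.+1%:R * t ^+ n).
  by have := is_deriveX n.+1 (is_derive_id t (1 : R)); rewrite /GRing.scale /= mulr1 exprfctE.
split=> [s _|]; first exact: h.
by apply: cvg_at_right_filter; exact: is_derive_continuous (h 0).
Qed.

Context {X : Type} (n : X -> nat) (kappa : R).
Hypothesis kappa0 : 0 < kappa.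

(** What a backward inequality retains once the jumps are forgotten: the rate out of [x] is at most
    [kappa * n x], a jump raises [n] by at most one, and it lowers the value by at most
    [D x t + m]. *)
Definition supersolution (D D' : X -> R -> R) : Prop :=
  forall x t m, 0 < t -> 0 <= m ->
    (forall y, (n y <= (n x).+1)%N -> - m <= D y t) ->
    - (kappa * (n x)%:R * (D x t + m)) <= D' x t.

(* A negative value at [x] comes from states of size at most [n x + j] within
   [j] steps, whose rates grow linearly: iterating the inequality [j] times gives
   the lower bound [- M * 'C(n x + j, j) * (kappa * t) ^+ j], which tends to [0]
   when [4 * kappa * t <= 1]. *)
Lemma supersolution_short_time (D D' : X -> R -> R) (M T : R) :
  (forall x, der0 (D x) (D' x)) -> supersolution D D' -> (forall x, 0 <= D x 0) ->
  0 <= M -> (forall x t, 0 <= t -> t <= T -> - M <= D x t) -> kappa * T <= 4^-1 ->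
  forall x t, 0 <= t -> t <= T -> 0 <= D x t.
Proof.
move=> dD sD D0 M0 DM kT.
have key (k : nat) x t : 0 <= t -> t <= T ->
    - (M * 'C(n x + k, k)%:R * (kappa * t) ^+ k) <= D x t.
  elim: k x t => [|k ih] x t t0 tT; first by rewrite expr0 bin0 !mulr1; exact: DM.
  set N := n x; set beta := M * 'C(N + k.+1, k.+1)%:R * kappa ^+ k.+1.
  pose c := kappa * N%:R.
  (* The factor [expR (c * t)] cancels the loss [c * D x t], and [beta * t ^+ k.+1] makes up for the
     loss [c * m] caused by the neighbours. *)
  have := der0M _ _ _ _ (der0_expR c)
    (der0D _ _ _ _ (dD x) (der0Z beta _ _ (der0_exprn k))).
  move=> /der0_nondecreasing /(_ _ 0 t (lexx _) t0 tT) /= h.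
  have {h} : 0 <= D x t + beta * t ^+ k.+1.
    rewrite -(pmulr_rge0 _ (expR_gt0 (c * t))); apply: le_trans (h _).
      by rewrite mulr0 expR0 mul1r expr0n /= mulr0 addr0 D0.
    move=> {h t t0 tT} s s0 sT.
    pose m := M * 'C(N + k.+1, k)%:R * (kappa * s) ^+ k.
    have m0 : 0 <= m.
      apply: mulr_ge0; first exact: mulr_ge0.
      by rewrite exprn_ge0// mulr_ge0// ltW.
    have := sD x s m s0 m0; rewrite -/N => h.
    have {}h : - (c * (D x s + m)) <= D' x s.
      apply: h => y yN; apply: le_trans (ih y s (ltW s0) (ltW sT)).
      rewrite lerN2; apply: ler_wpM2r; first by rewrite exprn_ge0// mulr_ge0// ltW.
      apply: ler_wpM2l => //; rewrite ler_nat; apply: leq_bin2l.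
      by rewrite addnS -addSn leq_add2r.
    have -> : c * expR (c * s) * (D x s + beta * s ^+ k.+1) +
      expR (c * s) * (D' x s + beta * (k.+1%:R * s ^+ k)) = expR (c * s) *
       (c * beta * s ^+ k.+1 + (D' x s + c * (D x s + m)) +
        (beta * (k.+1%:R * s ^+ k) - c * m)) by ring.
    apply: mulr_ge0; first exact: expR_ge0.
    have b0 : 0 <= beta by rewrite !mulr_ge0// exprn_ge0// ltW.
    apply: addr_ge0; first apply: addr_ge0.
    - by rewrite !mulr_ge0// ?exprn_ge0 ?ltW.
    - by rewrite -lerBlDr sub0r.
    - rewrite subr_ge0 /c /m /beta exprMn.
      have -> : kappa * N%:R * (M * 'C(N + k.+1, k)%:R * (kappa ^+ k * s ^+ k)) =
        M * (kappa ^+ k.+1 * s ^+ k) * (N%:R * 'C(N + k.+1, k)%:R).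
        by rewrite exprS; ring.
      have -> : M * 'C(N + k.+1, k.+1)%:R * kappa ^+ k.+1 * (k.+1%:R * s ^+ k) =
        M * (kappa ^+ k.+1 * s ^+ k) * (k.+1%:R * 'C(N + k.+1, k.+1)%:R) by ring.
      apply: ler_wpM2l; first by rewrite !mulr_ge0// exprn_ge0// ltW.
      (* [k.+1 * 'C(N + k.+1, k.+1)] equals [N.+1 * 'C(N + k.+1, k)], to be compared with the factor
         [N]. *)
      rewrite -!natrM ler_nat mul_bin_left leq_mul2r addnS subSn ?leq_addl//.
      by rewrite addnK leqnSn orbT.
  rewrite -lerBlDr sub0r; congr (_ <= _); rewrite /beta exprMn; ring.
move=> x t t0 tT; apply/ler_addgt0Pr => e e0; rewrite addrC -lerBlDr sub0r.
pose c := M * 2 ^+ n x.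
have c0 : 0 <= c by rewrite mulr_ge0// exprn_ge0.
have : c * (2^-1 : R) ^+ k @[k --> \oo] --> (0 : R).
  rewrite -[X in _ --> X](mulr0 c); apply: cvgM; first exact: cvg_cst.
  by apply: cvg_expr; rewrite ger0_norm ?invr_ge0// invf_lt1// ltr1n.
move=> /cvgrPdist_lt /(_ _ e0) [k _ /(_ k (leqnn k))] /=.
rewrite sub0r normrN ger0_norm ?mulr_ge0 ?exprn_ge0 ?invr_ge0// => ke.
rewrite lerNl; apply: le_trans (key k _ _ t0 tT); rewrite lerN2; apply: le_trans (ltW ke).
have -> : c * 2^-1 ^+ k = M * 2 ^+ (n x + k) * 4^-1 ^+ k.
  rewrite /c exprD -!mulrA; congr (_ * (_ * _)).
  by rewrite -exprMn; congr (_ ^+ _); field.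
apply: ler_pM.
- by rewrite mulr_ge0.
- by rewrite exprn_ge0// mulr_ge0// ltW.
- apply: ler_wpM2l => //; rewrite -natrX ler_nat.
  rewrite -[X in (_ <= X ^ _)%N]/(1 + 1)%N expnDn.
  under eq_bigr do rewrite !exp1n !muln1.
  by rewrite (bigD1 (inord k)) //= inordK ?leq_addr// ltnS leq_addl.
- apply: lerXn2r; rewrite ?nnegrE ?mulr_ge0 ?invr_ge0 ?(ltW kappa0)//.
  by apply: le_trans kT; rewrite ler_pM2l.
Qed.

(** The length [1 / (4 * kappa)] does not depend on the lower bound [M], so finitely many restarts
    reach any time. That the bound is uniform over all states on bounded time intervals is what
    rules out contributions from infinity. *)
Lemma supersolution_ge0 (D D' : X -> R -> R) :
  (forall x, der0 (D x) (D' x)) -> supersolution D D' -> (forall x, 0 <= D x 0) ->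
  (forall T, exists M, forall x t, 0 <= t -> t <= T -> - M <= D x t) ->
  forall x t, 0 <= t -> 0 <= D x t.
Proof.
move=> dD sD D0 DM x t t0.
pose T := (4 * kappa)^-1.
have T0 : 0 < T by rewrite invr_gt0 mulr_gt0.
have [j tj] : exists j : nat, t <= j%:R * T.
  exists (Num.truncn (t / T)).+1; rewrite -ler_pdivrMr//.
  by apply: ltW; exact: truncnS_gt.
elim: j x t t0 tj => [|j ih] x t t0 tj.
  have -> : t = 0 by apply/eqP; rewrite eq_le t0 andbT -(mul0r T).
  exact: D0.
have [|jt] := leP t (j%:R * T); first exact: ih.
pose a := j%:R * T.
have a0 : 0 <= a by rewrite mulr_ge0// ltW.
have [M hM] := DM (a + T).
have := @supersolution_short_time (fun x t => D x (a + t)) (fun x t => D' x (a + t))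
  `|M| T _ _ _ _ _ _ x (t - a).
rewrite /= (_ : a + (t - a) = t); last by ring.
apply.
- by move=> y; exact: der0_shift.
- by move=> y s m s0 m0 h; apply: sD => //; rewrite ltr_wpDl.
- by move=> y; rewrite addr0; apply: ih.
- exact: normr_ge0.
- move=> y s s0 sT; apply: le_trans (hM _ _ _ _).
  + by rewrite lerN2 ler_norm.
  + by rewrite addr_ge0.
  + by rewrite lerD2l.
- by rewrite /T invfM mulrC -mulrA mulVf ?mulr1// gt_eqF.
- by rewrite subr_ge0 ltW.
- by rewrite lerBlDl (le_trans tj)// /a -natr1 mulrDl mul1r.
Qed.

End MaximumPrinciple.

(** * Transition semigroups and the backward equation *)

Section Esum.
Context {R : realType}.
Local Open Scope ereal_scope.

Lemma esumZl (S : choiceType) (c : R) (a : S -> \bar R) : (0 <= c)%R ->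
  (forall i, 0 <= a i) ->
  \esum_(i in [set: S]) (c%:E * a i) = c%:E * \esum_(i in [set: S]) a i.
Proof.
move=> c0 a0.
have le (d : R) (b : S -> \bar R) : (0 <= d)%R -> (forall i, 0 <= b i) ->
    \esum_(i in [set: S]) (d%:E * b i) <= d%:E * \esum_(i in [set: S]) b i.
  move=> d0 b0; apply: ge_ereal_sup => _ [X [fX _] <-].
  rewrite -ge0_mule_fsumr//; apply: lee_wpmul2l; first by rewrite lee_fin.
  by apply: ereal_sup_ubound; exists X.
apply/eqP; rewrite eq_le le//=.
have [<-|{}c0] : (0 = c)%R \/ (0 < c)%R by move: c0; rewrite le_eqVlt => /orP[/eqP|]; [left|right].
  by rewrite mul0e; apply: esum_ge0 => i _; rewrite mul0e.
have ca0 i : 0 <= c%:E * a i by rewrite mule_ge0// lee_fin ltW.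
have ci0 : (0 <= c^-1)%R by rewrite invr_ge0 ltW.
have := le c^-1%R _ ci0 ca0.
under eq_esum do rewrite muleA -EFinM mulVf ?gt_eqF// mul1e.
have cc : (0 <= c)%R := ltW c0.
move=> h; have := @lee_wpmul2l R c%:E; rewrite lee_fin => /(_ cc _ _ h).
by rewrite muleA -EFinM mulfV ?gt_eqF// mul1e.
Qed.

Lemma esum_exchange (S T : choiceType) (a : S -> T -> \bar R) :
  (forall i j, 0 <= a i j) ->
  \esum_(i in [set: S]) \esum_(j in [set: T]) a i j =
  \esum_(j in [set: T]) \esum_(i in [set: S]) a i j.
Proof.
have TT (A B : Type) : [set: A] `*`` (fun=> [set: B]) = setT by apply/seteqP.
move=> a0; rewrite !esum_esum// !TT.
rewrite (reindex_esum (@setT (T * S)) _ (fun k => (k.2, k.1)))//=.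
split=> //= [[i j] [i' j'] _ _ [-> ->]|[i j] _]//.
by exists (j, i).
Qed.

End Esum.

Lemma cvg_sumr {R : realType} (T I : Type) (F : set_system T) (s : seq I)
    (u : I -> T -> R) (l : I -> R) : Filter F ->
  (forall i, u i t @[t --> F] --> l i) ->
  \sum_(i <- s) u i t @[t --> F] --> \sum_(i <- s) l i.
Proof.
move=> FF ul; elim: s => [|i s ih].
  by under eq_fun do rewrite big_nil; rewrite big_nil; exact: cvg_cst.
by under eq_fun do rewrite big_cons; rewrite big_cons; exact: cvgD.
Qed.

Section Semigroup.
Context {R : realType} {S : choiceType} (p : R -> S -> S -> R).
Hypothesis tp : transition_function p.
Implicit Types (f : S -> R) (s t : R) (x y : S).

Definition semigroup f t x : R :=
  fine (\esum_(y in [set: S]) (p t x y * f y)%:E).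

Definition unit_valued f := forall y, 0 <= f y <= 1.

Lemma transition_ge0 t x y : 0 <= t -> 0 <= p t x y.
Proof. by case: tp => h _ _ _; exact: h. Qed.

Lemma esum_semigroup_le1 f t x : unit_valued f -> 0 <= t ->
  (\esum_(y in [set: S]) (p t x y * f y)%:E <= 1)%E.
Proof.
move=> f01 t0; case: tp => p0 p1 _ _; rewrite -(p1 t x t0).
apply: le_esum => y _; rewrite lee_fin ler_piMr ?p0//.
by case/andP: (f01 y).
Qed.

Lemma semigroup_term_ge0 f t x y : unit_valued f -> 0 <= t -> 0 <= p t x y * f y.
Proof.
by move=> f01 t0; rewrite mulr_ge0 ?transition_ge0//; case/andP: (f01 y).
Qed.

Lemma semigroupE f t x : unit_valued f -> 0 <= t ->
  (semigroup f t x)%:E = \esum_(y in [set: S]) (p t x y * f y)%:E.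
Proof.
move=> f01 t0; rewrite fineK// ge0_fin_numE ?esum_ge0//.
  exact: le_lt_trans (esum_semigroup_le1 _ _ x f01 t0) (ltry _).
by move=> y _; rewrite lee_fin semigroup_term_ge0.
Qed.

Lemma unit_valued_semigroup f t : unit_valued f -> 0 <= t ->
  unit_valued (semigroup f t).
Proof.
move=> f01 t0 x; rewrite -!lee_fin semigroupE// esum_semigroup_le1// andbT.
by apply: esum_ge0 => y _; rewrite lee_fin semigroup_term_ge0.
Qed.

Lemma semigroupD f s t x : unit_valued f -> 0 <= s -> 0 <= t ->
  semigroup f (s + t) x = semigroup (semigroup f t) s x.
Proof.
move=> f01 s0 t0; apply: EFin_inj; rewrite !semigroupE ?addr_ge0//; last first.
  exact: unit_valued_semigroup.
case: tp => p0 _ _ pD.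
have e (y z : S) : (0 <= (p s x y * p t y z * f z)%:E)%E.
  by rewrite lee_fin !mulr_ge0 ?p0//; case/andP: (f01 z).
transitivity (\esum_(z in [set: S]) \esum_(y in [set: S])
   (p s x y * p t y z * f z)%:E)%E.
  apply: eq_esum => z _; rewrite EFinM muleC pD// -esumZl//.
  - by apply: eq_esum => y _; rewrite -!EFinM mulrC.
  - by case/andP: (f01 z).
  - by move=> y; rewrite lee_fin mulr_ge0 ?p0.
rewrite esum_exchange//; apply: eq_esum => y _.
rewrite EFinM semigroupE// -esumZl ?p0//.
  by apply: eq_esum => z _; rewrite -EFinM mulrA.
by move=> z; rewrite lee_fin semigroup_term_ge0.
Qed.

Lemma semigroup0 f x : unit_valued f -> semigroup f 0 x = f x.
Proof.
move=> f01; apply: EFin_inj; rewrite semigroupE//; case: tp => _ _ pI _.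
rewrite (esumID [set x])//; last by move=> y _; rewrite lee_fin semigroup_term_ge0.
rewrite setTI esum_set1 ?lee_fin ?semigroup_term_ge0// pI eqxx mul1r.
rewrite esum1 ?adde0// => y [_ /eqP]; rewrite pI eq_sym => /negbTE->.
by rewrite mul0r.
Qed.

(** As [f] lies between [0] and [1], the error is at most the mass outside [N], which is computed by
    applying the same splitting to the constant [1]. *)
Lemma semigroup_approx f s x (N : seq S) : unit_valued f -> 0 <= s -> uniq N ->
  `|semigroup f s x - \sum_(y <- N) p s x y * f y| <= 1 - \sum_(y <- N) p s x y.
Proof.
move=> f01 s0 uN; have [p0 p1 _ _] := tp.
have split_sum g : unit_valued g ->
    exists2 r : R, 0 <= r & semigroup g s x = \sum_(y <- N) p s x y * g y + r /\
      r%:E = \esum_(y in ~` [set` N]) (p s x y * g y)%:E.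
  move=> g01.
  have t0 (y : S) : (0 <= (p s x y * g y)%:E)%E by rewrite lee_fin semigroup_term_ge0.
  pose r := \esum_(y in ~` [set` N]) (p s x y * g y)%:E.
  have eN : (semigroup g s x)%:E = ((\sum_(y <- N) p s x y * g y)%:E + r)%E.
    rewrite semigroupE// (esumID [set` N])// !setTI; congr (_ + _)%E.
    by rewrite esum_fset// -fsbig_seq// sumEFin.
  have r0 : (0 <= r)%E by apply: esum_ge0.
  have rfin : r \is a fin_num.
    rewrite ge0_fin_numE//; have := ltry (semigroup g s x); rewrite eN.
    by case: (r) r0 => [u _ _||]; rewrite ?ltry ?addey.
  exists (fine r); first exact: fine_ge0.
  by rewrite fineK//; split=> //; apply: EFin_inj; rewrite eN EFinD fineK.
have [r r0 [-> rE]] := split_sum _ f01.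
have one01 : unit_valued (fun=> 1) by move=> y; rewrite ler01 lexx.
have [r' _ [+ rE']] := split_sum _ one01.
have -> : semigroup (fun=> 1) s x = 1.
  apply: EFin_inj; rewrite semigroupE// -(p1 s x)//; apply: eq_esum => y _.
  by rewrite mulr1.
under eq_bigr do rewrite mulr1; move=> ->.
rewrite addrAC subrr add0r addrAC subrr add0r ger0_norm// -lee_fin rE rE'.
apply: le_esum => y _; rewrite lee_fin mulr1 ler_piMr ?p0//.
by case/andP: (f01 y).
Qed.

(* Since the rates out of [x] sum to [0] over the finite set [N], the mass that
   the transition function sends outside [N] in a short time [s] is [o(s)]. *)
Lemma semigroup_right_quotient (q : S -> S -> R) x (N : seq S) : has_rates p q ->
  uniq N -> x \in N -> \sum_(y <- N) q x y = 0 ->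
  exists2 eta : R -> R, eta s @[s --> 0^'+] --> (0 : R) &
    forall f t s, unit_valued f -> 0 <= t -> 0 < s ->
      `|s^-1 * (semigroup f (t + s) x - semigroup f t x)
        - \sum_(y <- N) q x y * semigroup f t y| <= eta s.
Proof.
move=> pq uN xN q0.
pose e s y := s^-1 * (p s x y - (x == y)%:R).
exists (fun s => \sum_(y <- N) `|e s y - q x y| - \sum_(y <- N) e s y).
  rewrite -[X in _ --> X](_ : \sum_(y <- N) `|q x y - q x y| - \sum_(y <- N) q x y = 0).
    apply: cvgB; apply: cvg_sumr => y; last exact: pq.
    by apply: cvg_norm; apply: cvgB; [exact: pq|exact: cvg_cst].
  by rewrite q0 subr0 big1// => y _; rewrite subrr normr0.
move=> f t s f01 t0 s0; have t01 := unit_valued_semigroup _ _ f01 t0.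
rewrite [t + s]addrC semigroupD ?(ltW s0)//.
have := semigroup_approx _ _ x _ t01 (ltW s0) uN.
set u := semigroup f t; set v := semigroup u s x => h.
have ux : u x = \sum_(y <- N) (x == y)%:R * u y.
  rewrite (bigD1_seq x)//= eqxx mul1r big1 ?addr0// => y.
  by rewrite eq_sym => /negbTE->; rewrite mul0r.
have -> : s^-1 * (v - u x) - \sum_(y <- N) q x y * u y =
    s^-1 * (v - \sum_(y <- N) p s x y * u y) + \sum_(y <- N) (e s y - q x y) * u y.
  have -> : \sum_(y <- N) (e s y - q x y) * u y =
      s^-1 * (\sum_(y <- N) p s x y * u y) - s^-1 * u x - \sum_(y <- N) q x y * u y.
    rewrite ux !mulr_sumr -!sumrB; apply: eq_bigr => y _; rewrite /e; ring.
  ring.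
rewrite addrC; apply: le_trans (ler_normD _ _) _; apply: lerD.
  apply: le_trans (ler_norm_sum _ _ _) _; apply: ler_sum => y _.
  by rewrite normrM ler_piMr//; have /andP[? ?] := t01 y; rewrite ger0_norm.
rewrite normrM gtr0_norm ?invr_gt0//.
have -> : - (\sum_(y <- N) e s y) = s^-1 * (1 - \sum_(y <- N) p s x y).
  rewrite /e -mulr_sumr -mulrN -sumrN; congr (_ * _).
  rewrite [X in _ = X - _](_ : 1 = \sum_(y <- N) (x == y)%:R); last first.
    rewrite (bigD1_seq x)//= eqxx big1 ?addr0// => y.
    by rewrite eq_sym => /negbTE->.
  by rewrite -sumrB; apply: eq_bigr => y _; rewrite opprB.
by rewrite ler_pM2l ?invr_gt0.
Qed.

End Semigroup.

(** * The generator on trees *)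

(** Named copies of the local fixpoints of [adjunctions] and [deletions], to make induction on the
    list of subtrees possible. *)
Fixpoint adjunctions_forest (cs : seq tree) : seq (seq tree) :=
  if cs is c :: cs' then
    [seq c' :: cs' | c' <- adjunctions c] ++ [seq c :: s | s <- adjunctions_forest cs']
  else [::].

Fixpoint deletions_forest (cs : seq tree) : seq (seq tree) :=
  if cs is c :: cs' then
    (if c is Node [::] then [:: cs'] else [seq c' :: cs' | c' <- deletions c])
    ++ [seq c :: s | s <- deletions_forest cs']
  else [::].

Lemma adjunctionsE (cs : seq tree) : adjunctions (Node cs) =
  Node (rcons cs single_vertex) :: map Node (adjunctions_forest cs).
Proof. by rewrite /=; congr (_ :: map _ _); elim: cs => //= c cs ->. Qed.

Lemma deletionsE (cs : seq tree) : deletions (Node cs) = map Node (deletions_forest cs).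
Proof. by rewrite /=; congr (map _ _); elim: cs => //= c cs ->. Qed.

Fixpoint tree_size (t : tree) : nat :=
  let: Node cs := t in (foldr (fun c m => tree_size c + m) 0 cs).+1%N.

Definition forest_size (cs : seq tree) : nat := foldr (fun c m => tree_size c + m)%N 0%N cs.

Arguments forest_size : simpl never.

Lemma tree_sizeE (cs : seq tree) : tree_size (Node cs) = (forest_size cs).+1.
Proof. by []. Qed.

Lemma forest_size_cons (c : tree) (cs : seq tree) :
  forest_size (c :: cs) = (tree_size c + forest_size cs)%N.
Proof. by []. Qed.

Lemma forest_size_rcons (c : tree) (cs : seq tree) :
  forest_size (rcons cs c) = (forest_size cs + tree_size c)%N.
Proof.
elim: cs => [|d cs ih]; first by rewrite /forest_size /= addn0.
by rewrite rcons_cons !forest_size_cons ih addnA.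
Qed.

Lemma tree_size_gt0 (c : tree) : (0 < tree_size c)%N.
Proof. by case: c. Qed.

Lemma size_adjunctions (t : tree) : size (adjunctions t) = tree_size t.
Proof.
move: t; fix IH 1 => -[cs]; rewrite adjunctionsE /= size_map; congr S.
by elim: cs => //= c cs ih; rewrite size_cat !size_map ih IH.
Qed.

Lemma size_deletions (t : tree) : (size (deletions t) <= tree_size t)%N.
Proof.
move: t; fix IH 1 => -[cs]; rewrite deletionsE /= size_map; apply: leqW.
elim: cs => //= c cs ih; rewrite size_cat size_map leq_add//.
have := IH c; case: c => -[|c' cs'] // le; by rewrite size_map.
Qed.

Lemma tree_size_adjunctions (t t' : tree) : t' \in adjunctions t ->
  tree_size t' = (tree_size t).+1.
Proof.
move: t t'; fix IH 1 => -[cs] t'; rewrite adjunctionsE inE => /orP[/eqP->|].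
  by rewrite !tree_sizeE forest_size_rcons addn1.
move=> /mapP[l + ->{t'}]; rewrite !tree_sizeE => lcs; congr S.
elim: cs l lcs => //= c cs ih l; rewrite mem_cat => /orP[] /mapP[].
  by move=> c' /IH cc' ->; rewrite forest_size_cons cc'.
by move=> l' /ih ll' ->; rewrite !forest_size_cons ll' addnS.
Qed.

Lemma tree_size_deletions (t t' : tree) : t' \in deletions t ->
  (tree_size t' <= tree_size t)%N.
Proof.
move: t t'; fix IH 1 => -[cs] t'; rewrite deletionsE.
move=> /mapP[l + ->{t'}]; rewrite !tree_sizeE ltnS => lcs.
elim: cs l lcs => //= c cs ih l; rewrite mem_cat => /orP[]; last first.
  by move=> /mapP[l' /ih ll' ->]; rewrite !forest_size_cons leq_add2l.
case: c (IH c) => -[|d ds] IHc.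
  by rewrite inE => /eqP->; exact: leq_addl.
by move=> /mapP[c' /IHc cc' ->]; rewrite !forest_size_cons leq_add2r.
Qed.

Section Generator.
Context {R : realType} (lambda mu : R).
Hypotheses (lambda0 : 0 < lambda) (mu0 : 0 < mu).

Definition generator (g : tree -> R) (x : tree) : R :=
  lambda * (\sum_(y <- adjunctions x) (g y - g x))
  + mu * (\sum_(y <- deletions x) (g y - g x)).

(** A finite support of the row of the rate matrix at [x], diagonal included. Duplicates are removed
    because [tree_rate] already counts multiplicities. *)
Definition neighbourhood (x : tree) : seq tree :=
  undup (x :: adjunctions x ++ deletions x).

Lemma sum_count_mem (I : eqType) (N s : seq I) (g : I -> R) : uniq N ->
  {subset s <= N} -> \sum_(y <- N) (count_mem y s)%:R * g y = \sum_(y <- s) g y.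
Proof.
move=> uN; elim: s => [|z s ih] sN.
  by rewrite big_nil big1// => y _; rewrite mul0r.
rewrite big_cons -ih; last by move=> y ys; apply: sN; rewrite inE ys orbT.
under eq_bigr do rewrite /= natrD mulrDl; rewrite big_split/=; congr (_ + _).
rewrite (bigD1_seq z)//=; last by apply: sN; rewrite inE eqxx.
rewrite eqxx mul1r big1 ?addr0// => y; rewrite eq_sym => /negbTE->.
by rewrite mul0r.
Qed.

Lemma sum_tree_rate (g : tree -> R) (x : tree) :
  \sum_(y <- neighbourhood x) tree_rate lambda mu x y * g y = generator g x.
Proof.
have uN : uniq (neighbourhood x) by exact: undup_uniq.
have sub (s : seq tree) : {subset s <= x :: adjunctions x ++ deletions x} ->
    {subset s <= neighbourhood x} by move=> sN y /sN; rewrite mem_undup.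
have -> : \sum_(y <- neighbourhood x) tree_rate lambda mu x y * g y =
  lambda * (\sum_(y <- neighbourhood x) (count_mem y (adjunctions x))%:R * g y) +
  mu * (\sum_(y <- neighbourhood x) (count_mem y (deletions x))%:R * g y) -
  (lambda * (size (adjunctions x))%:R + mu * (size (deletions x))%:R) *
  (\sum_(y <- neighbourhood x) (count_mem y [:: x])%:R * g y).
  rewrite !mulr_sumr -big_split -sumrB/=; apply: eq_bigr => y _.
  rewrite /tree_rate addn0; ring.
have subA : {subset adjunctions x <= neighbourhood x}.
  by apply: sub => y ys; rewrite inE mem_cat ys orbT.
have subD : {subset deletions x <= neighbourhood x}.
  by apply: sub => y ys; rewrite inE mem_cat ys !orbT.
have subx : {subset [:: x] <= neighbourhood x}.
  by apply: sub => y; rewrite !inE => ->.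
rewrite !sum_count_mem//.
rewrite big_seq1 /generator !sumrB !big_const_seq !count_predT !iter_addr_0.
rewrite -(mulr_natr (g x) (size (adjunctions x))).
rewrite -(mulr_natr (g x) (size (deletions x))); ring.
Qed.

Definition option_cons (o : option tree) (cs : seq tree) : seq tree :=
  if o is Some c then c :: cs else cs.

(* The generator of a subtree of the root, [None] being the state in which this
   subtree has been deleted. *)
Definition subtree_generator (phi : option tree -> R) (c : tree) : R :=
  generator (phi \o Some) c + mu * (c == single_vertex)%:R * (phi None - phi (Some c)).

(** The subtrees move one at a time, the others being frozen; births at the root are kept apart and
    enter in [generator_Node]. *)
Fixpoint forest_generator (g : seq tree -> R) (cs : seq tree) : R :=
  if cs is c :: cs' then
    subtree_generator (fun o => g (option_cons o cs')) c
    + forest_generator (fun l => g (c :: l)) cs'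
  else 0.

Lemma generator_Node (g : tree -> R) (cs : seq tree) : generator g (Node cs) =
  lambda * (g (Node (rcons cs single_vertex)) - g (Node cs))
  + forest_generator (g \o Node) cs.
Proof.
rewrite /generator adjunctionsE deletionsE big_cons !big_map mulrDr -addrA.
congr (_ + _).
have : forall G : seq tree -> R, lambda * (\sum_(l <- adjunctions_forest cs) (G l - G cs))
  + mu * (\sum_(l <- deletions_forest cs) (G l - G cs)) = forest_generator G cs.
  elim: cs => [|c cs ih] G /=; first by rewrite !big_nil !mulr0 addr0.
  rewrite -ih !big_cat !big_map/= /subtree_generator /generator !mulrDr /=.
  (* A subtree reduced to a single vertex has no deletion of its own, but it is a leaf of the whole
     tree and can disappear: this is the [None] term. *)
  have -> : mu * (\sum_(l <- match c with Node [::] => [:: cs]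
      | Node (_ :: _) => [seq c' :: cs | c' <- deletions c] end) (G l - G (c :: cs))) =
    mu * (\sum_(y <- deletions c) (G (y :: cs) - G (c :: cs)))
    + mu * (c == single_vertex)%:R * (G cs - G (c :: cs)).
    case: c => -[|d ds]; first by rewrite big_seq1 big_nil eqxx mulr0 add0r mulr1.
    by rewrite big_map (_ : _ == _ = false) ?mulr0 ?mul0r ?addr0//; apply/eqP.
  ring.
exact.
Qed.

Lemma subtree_generator_eq (phi psi : option tree -> R) c : phi =1 psi ->
  subtree_generator phi c = subtree_generator psi c.
Proof. by move=> /funext->. Qed.

Lemma generatorZ (a : R) (g : tree -> R) c :
  generator (fun x => a * g x) c = a * generator g c.
Proof.
rewrite /generator; under eq_bigr do rewrite -mulrBr.
under [X in _ + mu * X]eq_bigr do rewrite -mulrBr.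
by rewrite -!mulr_sumr; ring.
Qed.

Lemma generatorB (g k : tree -> R) c :
  generator (fun x => g x - k x) c = generator g c - generator k c.
Proof.
have e (s : seq tree) : \sum_(y <- s) (g y - k y - (g c - k c)) =
    \sum_(y <- s) (g y - g c) - \sum_(y <- s) (k y - k c).
  by rewrite -sumrB; apply: eq_bigr => y _; ring.
by rewrite /generator !e; ring.
Qed.

Lemma generator_cst (a : R) c : generator (fun=> a) c = 0.
Proof.
have e (s : seq tree) : \sum_(y <- s) (a - a) = 0 by rewrite big1// => y _; rewrite subrr.
by rewrite /generator !e !mulr0 addr0.
Qed.

Lemma subtree_generatorZ (a : R) phi c :
  subtree_generator (fun o => a * phi o) c = a * subtree_generator phi c.
Proof. by rewrite /subtree_generator (generatorZ a (phi \o Some)) /=; ring. Qed.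

Lemma subtree_generatorB phi psi c :
  subtree_generator (fun o => phi o - psi o) c =
  subtree_generator phi c - subtree_generator psi c.
Proof.
by rewrite /subtree_generator (generatorB (phi \o Some) (psi \o Some)) /=; ring.
Qed.

Lemma forest_generatorZ (a : R) g cs :
  forest_generator (fun l => a * g l) cs = a * forest_generator g cs.
Proof.
elim: cs g => [|c cs ih] g /=; first by rewrite mulr0.
rewrite (ih (fun l => g (c :: l))) (subtree_generatorZ a (fun o => g (option_cons o cs))).
by rewrite -mulrDr.
Qed.

Lemma forest_generatorB g k cs :
  forest_generator (fun l => g l - k l) cs = forest_generator g cs - forest_generator k cs.
Proof.
elim: cs g k => [|c cs ih] g k /=; first by rewrite subr0.
by rewrite (ih (fun l => g (c :: l)) (fun l => k (c :: l))) subtree_generatorB; ring.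
Qed.

(** The second [mu] pays for the deletion of a subtree as a whole. *)
Definition total_rate : R := lambda + mu + mu.

Lemma total_rate_gt0 : 0 < total_rate.
Proof. by rewrite /total_rate !addr_gt0. Qed.

(** Both lists have at most [tree_size c] entries, and each entry costs at most [g c + m]. *)
Lemma generator_ge (g : tree -> R) (m : R) c :
  (forall y, (tree_size y <= (tree_size c).+1)%N -> - m <= g y) ->
  - ((lambda + mu) * (tree_size c)%:R * (g c + m)) <= generator g c.
Proof.
move=> gm; have gc : 0 <= g c + m by rewrite -lerBlDr sub0r gm.
have le (s : seq tree) : (size s <= tree_size c)%N ->
    (forall y, y \in s -> (tree_size y <= (tree_size c).+1)%N) ->
    - ((tree_size c)%:R * (g c + m)) <= \sum_(y <- s) (g y - g c).
  move=> sc ys; apply: (@le_trans _ _ (\sum_(y <- s) - (g c + m))).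
    rewrite big_const_seq count_predT iter_addr_0 -[_ *+ size s]mulr_natl mulrN lerN2.
    by rewrite ler_wpM2r// ler_nat.
  rewrite !big_seq; apply: ler_sum => y /ys /gm; rewrite opprD addrC => h.
  by rewrite lerD2r.
have h1 := le _ (eq_leq (size_adjunctions c)) (fun y yc => eq_leq (tree_size_adjunctions _ _ yc)).
have h2 := le _ (size_deletions c) (fun y yc => leqW (tree_size_deletions _ _ yc)).
rewrite /generator -!mulrA mulrDl opprD; apply: lerD; by rewrite -mulrN ler_pM2l.
Qed.

Lemma subtree_generator_ge (phi : option tree -> R) (m : R) c : - m <= phi None ->
  (forall y, (tree_size y <= (tree_size c).+1)%N -> - m <= phi (Some y)) ->
  - (total_rate * (tree_size c)%:R * (phi (Some c) + m)) <= subtree_generator phi c.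
Proof.
move=> pn pm; have gc : 0 <= phi (Some c) + m by rewrite -lerBlDr sub0r pm.
rewrite /subtree_generator /total_rate -mulrA mulrDl opprD mulrA; apply: lerD.
  exact: (generator_ge (phi \o Some)).
apply: (@le_trans _ _ (- (mu * (phi (Some c) + m)))).
  rewrite lerN2 ler_pM2l// ler_peMl// ler1n; exact: tree_size_gt0.
case: (c == _); rewrite ?mulr1.
  by rewrite -mulrN ler_pM2l// opprD addrC lerD2r.
by rewrite mulr0 mul0r oppr_le0 mulr_ge0// ltW.
Qed.

Lemma forest_generator_ge (g : seq tree -> R) (m : R) cs :
  (forall l, (forest_size l <= (forest_size cs).+1)%N -> - m <= g l) ->
  - (total_rate * (forest_size cs)%:R * (g cs + m)) <= forest_generator g cs.
Proof.
elim: cs g => [|c cs ih] g gm; first by rewrite mulr0 mul0r oppr0.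
rewrite forest_size_cons natrD (mulrDr total_rate) (mulrDl _ _ (g _ + m)) opprD /=.
apply: lerD.
  apply: (@subtree_generator_ge (fun o => g (option_cons o cs))) => [|y yc].
    by apply: gm; rewrite forest_size_cons -addnS; exact: leq_trans (leqnSn _) (leq_addl _ _).
  by apply: gm; rewrite /= !forest_size_cons -addSn leq_add2r.
apply: (ih (fun l => g (c :: l))) => l lcs.
by apply: gm; rewrite !forest_size_cons -addnS leq_add2l.
Qed.

End Generator.

(** * The backward equation of the tree process *)

Section TreeSemigroup.
Context {R : realType} (lambda mu : R) (p : R -> tree -> tree -> R).
Hypotheses (tp : transition_function p) (rp : has_rates p (tree_rate lambda mu)).

(** Each row of rates has finite support and sums to [0], as [semigroup_right_quotient] requires.
    Continuity is obtained at all trees first, because the derivative at [x] involves the values at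
    its neighbours. *)
Lemma semigroup_der0 (f : tree -> R) (x : tree) : unit_valued f ->
  der0 (fun t => semigroup p f t x) (fun t => generator lambda mu (semigroup p f t) x).
Proof.
move=> f01; set u := fun x t => semigroup p f t x.
pose g x t := \sum_(y <- neighbourhood x) tree_rate lambda mu x y * u y t.
have u01 t y : 0 <= t -> 0 <= u y t <= 1.
  by move=> t0; exact: (unit_valued_semigroup p tp f t f01 t0 y).
have key y : exists2 eta : R -> R, eta s @[s --> 0^'+] --> (0 : R) &
    forall t s, 0 <= t -> 0 < s -> `|s^-1 * (u y (t + s) - u y t) - g y t| <= eta s.
  have q0 : \sum_(z <- neighbourhood y) tree_rate lambda mu y z = 0.
    under eq_bigr do rewrite -[tree_rate _ _ _ _]mulr1.
    by rewrite (sum_tree_rate lambda mu (fun=> 1)) generator_cst.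
  have yN : y \in neighbourhood y by rewrite mem_undup inE eqxx.
  have [eta eta0 h] := semigroup_right_quotient p tp _ y _ rp (undup_uniq _) yN q0.
  by exists eta => // t s t0 s0; exact: h.
have gM y t : 0 <= t -> `|g y t| <= \sum_(z <- neighbourhood y) `|tree_rate lambda mu y z|.
  move=> t0; apply: le_trans (ler_norm_sum _ _ _) _; apply: ler_sum => z _.
  by rewrite normrM ler_piMr//; have /andP[? ?] := u01 _ z t0; rewrite ger0_norm.
have uc y : (forall t, 0 < t -> {for t, continuous (u y)}) /\ u y t @[t --> 0^'+] --> u y 0.
  have [eta eta0 h] := key y.
  exact: der0_of_right_quotient eta0 h (gM y).
have [eta eta0 h] := key x.
suff : der0 (u x) (g x) by move=> /der0_ext; apply=> t _; rewrite /g sum_tree_rate.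
split; last by case: (uc x).
apply: der0_of_right_quotient_cont eta0 h _ => t t0.
rewrite /g /continuous_at; apply: cvg_sumr => y.
by apply: cvgM; [exact: cvg_cst|case: (uc y) => + _; exact].
Qed.

End TreeSemigroup.

(** * Exchangeability of the subtrees at the root *)

Section HeightTail.
Context {R : realType} (lambda mu : R) (p : R -> tree -> tree -> R).
Hypotheses (lambda0 : 0 < lambda) (mu0 : 0 < mu).
Hypotheses (tp : transition_function p) (rp : has_rates p (tree_rate lambda mu)).
Variable h : nat.

Let subgen := subtree_generator lambda mu.
Let forgen := forest_generator lambda mu.
Let kappa := total_rate lambda mu.

Definition height_le (h : nat) (x : tree) : R := (height x <= h)%:R.

Lemma height_le01 (k : nat) : unit_valued (height_le k).
Proof. by move=> x; rewrite /height_le ler0n lern1 leq_b1. Qed.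

(* The probability that the tree with subtrees [cs] at the root has height at
   most [h] after time [t]. *)
Definition forest_cdf (cs : seq tree) (t : R) : R := semigroup p (height_le h) t (Node cs).
Local Notation V := forest_cdf.

Lemma forest_cdf_ge0 cs t : 0 <= t -> 0 <= V cs t.
Proof.
by move=> t0; have /andP[] := unit_valued_semigroup _ tp _ _ (height_le01 h) t0 (Node cs).
Qed.

Lemma forest_cdf_le1 cs t : 0 <= t -> V cs t <= 1.
Proof.
by move=> t0; have /andP[] := unit_valued_semigroup _ tp _ _ (height_le01 h) t0 (Node cs).
Qed.

Lemma forest_cdf0 cs : V cs 0 = height_le h (Node cs).
Proof. by rewrite /forest_cdf semigroup0//; exact: height_le01. Qed.

Lemma forest_cdf_der0 cs : der0 (V cs) (fun t =>
  lambda * (V (rcons cs single_vertex) t - V cs t) + forgen (V^~ t) cs).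
Proof.
apply: der0_ext (semigroup_der0 lambda mu p tp rp _ _ (height_le01 h)) _ => t _.
by rewrite generator_Node.
Qed.

(** It vanishes when the factor contributed by an additional subtree [c] is the same next to [A] as
    next to [B], which is independence written without a quotient. The products make it a function
    of independently moving [c], [A] and [B], with value [0] once [c] is deleted; hence it solves a
    closed linear equation. *)
Definition swap_gap (x : tree * seq tree * seq tree) (t : R) : R :=
  let: (c, A, B) := x in V (c :: A) t * V B t - V A t * V (c :: B) t.

Definition swap_gap' (x : tree * seq tree * seq tree) (t : R) : R :=
  let: (c, A, B) := x in
  lambda * (swap_gap (c, rcons A single_vertex, B) t - swap_gap x t)
  + lambda * (swap_gap (c, A, rcons B single_vertex) t - swap_gap x t)
  + subgen (fun o => if o is Some d then swap_gap (d, A, B) t else 0) c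
  + forgen (fun l => swap_gap (c, l, B) t) A
  + forgen (fun l => swap_gap (c, A, l) t) B.

Lemma swap_gap_der0 x : der0 (swap_gap x) (swap_gap' x).
Proof.
case: x => -[c A] B; rewrite /swap_gap /swap_gap'.
apply: der0_ext.
  apply: der0B; apply: der0M; exact: forest_cdf_der0.
move=> t _ /=.
have -> : subgen (fun o => if o is Some d then
    V (d :: A) t * V B t - V A t * V (d :: B) t else 0) c =
    V B t * subgen (fun o => V (option_cons o A) t) c
    - V A t * subgen (fun o => V (option_cons o B) t) c.
  rewrite /subgen -!subtree_generatorZ -subtree_generatorB.
  by apply: subtree_generator_eq => -[d|] /=; ring.
have -> : forgen (fun l => V (c :: l) t * V B t - V l t * V (c :: B) t) A =
    V B t * forgen (fun l => V (c :: l) t) A - V (c :: B) t * forgen (V^~ t) A.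
  rewrite /forgen -!forest_generatorZ -forest_generatorB.
  by congr forest_generator; apply/funext => l; ring.
have -> : forgen (fun l => V (c :: A) t * V l t - V A t * V (c :: l) t) B =
    V (c :: A) t * forgen (V^~ t) B - V A t * forgen (fun l => V (c :: l) t) B.
  by rewrite /forgen -!forest_generatorZ -forest_generatorB.
rewrite -/subgen -/forgen; ring.
Qed.

Definition swap_size (x : tree * seq tree * seq tree) : nat :=
  let: (c, A, B) := x in (tree_size c + forest_size A + forest_size B)%N.

Arguments swap_gap : simpl never.

(** The two births at the roots cost [lambda] each, which is at most [kappa * tree_size c]; together
    with the moves of the subtrees this explains the factor [3]. Applied with [e] of both signs. *)
Lemma swap_gap_supersolution (e : R) : supersolution swap_size (3 * kappa)
  (fun x t => e * swap_gap x t) (fun x t => e * swap_gap' x t).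
Proof.
move=> [[c A] B] t m t0 m0 H.
set D := e * swap_gap _ t.
have Dm : 0 <= D + m by rewrite -lerBlDr sub0r H.
have HA : - (lambda * (D + m)) <= lambda * (e * swap_gap (c, rcons A single_vertex, B) t - D).
  rewrite -mulrN ler_pM2l// opprD addrC lerD2r H//=.
  by rewrite forest_size_rcons addn1 !addnS addSn.
have HB : - (lambda * (D + m)) <= lambda * (e * swap_gap (c, A, rcons B single_vertex) t - D).
  rewrite -mulrN ler_pM2l// opprD addrC lerD2r H//=.
  by rewrite forest_size_rcons addn1 !addnS.
have Hc := @subtree_generator_ge _ lambda mu lambda0 mu0
  (fun o => e * if o is Some d then swap_gap (d, A, B) t else 0) m c.
have {}Hc : - (kappa * (tree_size c)%:R * (D + m)) <= e * subgen
   (fun o => if o is Some d then swap_gap (d, A, B) t else 0) c.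
  rewrite -subtree_generatorZ; apply: Hc; first by rewrite mulr0 oppr_le0.
  by move=> y yc; apply: H; rewrite /= -!addSn !leq_add2r.
have HFA := @forest_generator_ge _ lambda mu lambda0 mu0 (fun l => e * swap_gap (c, l, B) t) m A.
have {}HFA : - (kappa * (forest_size A)%:R * (D + m)) <=
    e * forgen (fun l => swap_gap (c, l, B) t) A.
  rewrite -forest_generatorZ; apply: HFA => l lA; apply: H.
  by rewrite /= -addSn -addnS leq_add2r leq_add2l.
have HFB := @forest_generator_ge _ lambda mu lambda0 mu0 (fun l => e * swap_gap (c, A, l) t) m B.
have {}HFB : - (kappa * (forest_size B)%:R * (D + m)) <=
    e * forgen (fun l => swap_gap (c, A, l) t) B.
  rewrite -forest_generatorZ; apply: HFB => l lB; apply: H.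
  by rewrite /= -addnS leq_add2l.
have lk : lambda <= kappa by rewrite /kappa /total_rate -addrA lerDl addr_ge0// ltW.
have k0 : 0 < kappa by exact: total_rate_gt0.
have c1 : 1 <= (tree_size c)%:R :> R by rewrite ler1n tree_size_gt0.
apply: (@le_trans _ _ (- ((lambda + lambda + kappa * (tree_size c)%:R +
   kappa * (forest_size A)%:R + kappa * (forest_size B)%:R) * (D + m)))).
  rewrite lerN2; apply: ler_wpM2r => //.
  rewrite /= !natrD.
  have : kappa <= kappa * (tree_size c)%:R by rewrite ler_peMr// ltW.
  have : 0 <= kappa * (forest_size A)%:R by rewrite mulr_ge0// ltW.
  have : 0 <= kappa * (forest_size B)%:R by rewrite mulr_ge0// ltW.
  move: lk; lra.
rewrite /swap_gap' /D /=.
move: HA HB Hc HFA HFB; rewrite /D; lra.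
Qed.

Lemma height_cons c cs : height (Node (c :: cs)) = maxn (height c).+1 (height (Node cs)).
Proof. by []. Qed.

(* Exchangeability of the subtrees at the root, in a form that the generator
   preserves. *)
Lemma swap_gap_eq0 x t : 0 <= t -> swap_gap x t = 0.
Proof.
move=> t0.
have k0 : 0 < 3 * kappa by rewrite mulr_gt0//; exact: total_rate_gt0.
have ge0 (e : R) : `|e| = 1 -> 0 <= e * swap_gap x t.
  move=> e1.
  apply: (@supersolution_ge0 _ _ swap_size _ k0 (fun x t => e * swap_gap x t)
    (fun x t => e * swap_gap' x t)) => //.
  - by move=> y; apply: der0Z; exact: swap_gap_der0.
  - exact: swap_gap_supersolution.
  (* At time [0] the gap vanishes because the event of height at most [h] is an intersection of one
     condition per subtree. *)
  - move=> [[c A] B]; rewrite /swap_gap !forest_cdf0 /height_le !height_cons !geq_max.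
    by rewrite -!natrM !mulnb andbCA andbA subrr mulr0.
  - move=> T; exists 1 => -[[c A] B] s s0 _.
    rewrite lerNl -mulrN; apply: le_trans (ler_norm _) _.
    rewrite normrM e1 mul1r /swap_gap normrN ler_norml.
    have := forest_cdf_ge0 (c :: A) _ s0; have := forest_cdf_ge0 (c :: B) _ s0.
    have := forest_cdf_le1 (c :: A) _ s0; have := forest_cdf_le1 (c :: B) _ s0.
    have := forest_cdf_ge0 A _ s0; have := forest_cdf_ge0 B _ s0.
    have := forest_cdf_le1 A _ s0; have := forest_cdf_le1 B _ s0.
    move: (V _ s) (V _ s) (V _ s) (V _ s) => a b c' d; nra.
apply/eqP; rewrite eq_le -oppr_ge0 -mulN1r ge0 ?normrN1//=.
by rewrite -[swap_gap x t]mul1r ge0// normr1.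
Qed.

End HeightTail.

(** * Survival of a single subtree of the root *)

Section SubtreeSurvival.
Context {R : realType} (lambda mu : R) (p : R -> tree -> tree -> R).
Hypotheses (lambda0 : 0 < lambda) (mu0 : 0 < mu).
Hypotheses (tp : transition_function p) (rp : has_rates p (tree_rate lambda mu)).
Variable h : nat.

Local Notation V := (forest_cdf p h).
Local Notation V_der0 := (forest_cdf_der0 _ _ _ tp rp h).

(** The root has had no child up to time [t] with at least this probability; analytically,
    [V' >= - lambda * V]. It allows division by [V [::] t]. *)
Lemma forest_cdf_nil_ge t : 0 <= t -> expR (- (lambda * t)) <= V [::] t.
Proof.
move=> t0; have d := der0M _ _ _ _ (der0_expR lambda) (V_der0 [::]).
have := der0_nondecreasing _ _ t d _ 0 t (lexx _) t0 (lexx _).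
rewrite mulr0 expR0 mul1r forest_cdf0// /height_le leq0n => H.
rewrite expRN -[X in X <= _]mul1r ler_pdivrMr ?expR_gt0// mulrC; apply: H => s s0 _.
rewrite /= addr0 (_ : _ + _ =
  expR (lambda * s) * (lambda * V [:: single_vertex] s)); last by ring.
rewrite !mulr_ge0 ?expR_ge0 ?(ltW lambda0)//.
exact: forest_cdf_ge0 tp h _ _ (ltW s0).
Qed.

Lemma forest_cdf_nil_gt0 t : 0 <= t -> 0 < V [::] t.
Proof. by move=> /forest_cdf_nil_ge; apply: lt_le_trans; exact: expR_gt0. Qed.

(* By [swap_gap_eq0], [V [:: c] t / V [::] t] is the probability that a subtree
   [c] of the root has been deleted by time [t] or does not bring the height of
   the tree above [h]. *)
Definition subtree_survival (c : tree) (t : R) : R := 1 - V [:: c] t / V [::] t.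
Local Notation z := subtree_survival.

Lemma subtree_survival_der0 c : der0 (z c) (fun t => subtree_generator lambda mu
  (fun o => if o is Some d then z d t else 0) c).
Proof.
have Vn0 t : 0 <= t -> V [::] t != 0 by move=> /forest_cdf_nil_gt0; rewrite lt0r => /andP[].
apply: der0_ext.
  apply: der0B; first exact: (der0_cst 1).
  by apply: der0M; [exact: V_der0|exact: der0V Vn0 (V_der0 _)].
move=> t t0 /=; have {}Vn0 := Vn0 _ (ltW t0).
(* Births at the root enter the derivative of the quotient through [V [:: c; single_vertex]] and [V
   [:: single_vertex]]; by this identity they cancel. *)
have := swap_gap_eq0 _ _ _ lambda0 mu0 tp rp h (c, [:: single_vertex], [::]) t (ltW t0).
rewrite /swap_gap => /eqP; rewrite subr_eq0 => /eqP sw.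
have {}sw : V [:: c; single_vertex] t = V [:: single_vertex] t * V [:: c] t / V [::] t.
  by rewrite -sw mulfK.
have -> : subtree_generator lambda mu (fun o => if o is Some d then z d t else 0) c =
   - (V [::] t)^-1 * subtree_generator lambda mu (fun o => V (option_cons o [::]) t) c.
  transitivity (subtree_generator lambda mu (fun=> 1) c -
      (V [::] t)^-1 * subtree_generator lambda mu (fun o => V (option_cons o [::]) t) c).
    rewrite -subtree_generatorZ -subtree_generatorB; apply: subtree_generator_eq.
    by move=> [d|]; rewrite /= /subtree_survival mulrC// divff// subrr.
  rewrite {1}/subtree_generator (generator_cst lambda mu 1) subrr mulr0 addr0.
  by rewrite sub0r mulNr.
by rewrite !addr0 sw; field.
Qed.

Lemma subtree_survival_le1 c t : 0 <= t -> z c t <= 1.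
Proof.
move=> t0; rewrite gerBl divr_ge0// ?(ltW (forest_cdf_nil_gt0 _ t0))//.
exact: forest_cdf_ge0 tp h _ _ t0.
Qed.

(** The edge joining the root to [c] accounts for the strict inequality. *)
Lemma subtree_survival0 c : z c 0 = 1 - (height c < h)%:R.
Proof.
rewrite /subtree_survival !forest_cdf0// /height_le height_cons /= maxn0.
by rewrite divr1.
Qed.

Lemma subtree_survival_ge0 c t : 0 <= t -> 0 <= z c t.
Proof.
move=> t0; apply: (@supersolution_ge0 _ _ tree_size _ (total_rate_gt0 _ _ lambda0 mu0) z
  (fun c t => subtree_generator lambda mu (fun o => if o is Some d then z d t else 0) c)) => //.
- exact: subtree_survival_der0.
- move=> d s m s0 m0 H.
  apply: (subtree_generator_ge _ _ lambda0 mu0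
    (fun o => if o is Some d then z d s else 0)) => //.
  by rewrite oppr_le0.
- by move=> d; rewrite subtree_survival0 subr_ge0 lern1 leq_b1.
(* The quotient in [z] is at most [1 / V [::] s], which is at most [expR (lambda * T)] whatever the
   subtree. *)
- move=> T; exists (expR (lambda * T)) => d s s0 sT.
  rewrite lerNl opprB lerBlDr; apply: (@le_trans _ _ (expR (lambda * T))); last first.
    by rewrite lerDl.
  rewrite ler_pdivrMr ?forest_cdf_nil_gt0//.
  apply: le_trans (forest_cdf_le1 _ tp h _ _ s0) _.
  rewrite -ler_pdivrMl ?expR_gt0// mulr1 -expRN.
  apply: le_trans (forest_cdf_nil_ge _ s0); rewrite ler_expR lerN2.
  by rewrite ler_pM2l.
Qed.

Lemma forest_cdf_nil_der0 :
  der0 (V [::]) (fun t => - (lambda * V [::] t * z single_vertex t)).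
Proof.
apply: der0_ext (V_der0 [::]) _ => t t0 /=.
have Vn0 : V [::] t != 0 by rewrite gt_eqF// forest_cdf_nil_gt0// ltW.
by rewrite addr0 /subtree_survival; field.
Qed.

End SubtreeSurvival.

(** * Laplace transforms *)

Section Laplace.
Context {R : realType}.
Implicit Types (a b c L M : R) (u v g : R -> R).

(* [L] is the integral of [expR (- a t) * u t] over [t >= 0]. *)
Definition is_laplace a u L : Prop := exists A : R -> R,
  [/\ A 0 = 0, der0 A (fun t => expR (- a * t) * u t) & A n%:R @[n --> \oo] --> L].

Lemma expR_nat_cvg0 a : 0 < a -> expR (- a * n%:R) @[n --> \oo] --> (0 : R).
Proof.
move=> a0; under eq_fun do rewrite mulNr expRN mulrC expRM_natl -exprVn.
apply: cvg_expr; rewrite ger0_norm ?invr_ge0 ?expR_ge0//.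
by rewrite invf_lt1 ?expR_gt0// expR_gt1.
Qed.

Lemma laplace_eq a u v L : is_laplace a u L -> (forall t, 0 < t -> u t = v t) ->
  is_laplace a v L.
Proof.
by move=> [A [A0 dA AL]] uv; exists A; split=> //; apply: der0_ext dA _ => t t0; rewrite uv.
Qed.

Lemma laplaceD a u v L M : is_laplace a u L -> is_laplace a v M ->
  is_laplace a (fun t => u t + v t) (L + M).
Proof.
move=> [A [A0 dA AL]] [B [B0 dB BM]]; exists (fun t => A t + B t).
split; [by rewrite A0 B0 addr0| |exact: cvgD].
by apply: der0_ext (der0D _ _ _ _ dA dB) _ => t _; rewrite mulrDr.
Qed.

Lemma laplaceZ a c u L : is_laplace a u L -> is_laplace a (fun t => c * u t) (c * L).
Proof.
move=> [A [A0 dA AL]]; exists (fun t => c * A t).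
split; [by rewrite A0 mulr0| |by apply: cvgM => //; exact: cvg_cst].
by apply: der0_ext (der0Z c _ _ dA) _ => t _; rewrite mulrCA.
Qed.

Lemma laplaceB a u v L M : is_laplace a u L -> is_laplace a v M ->
  is_laplace a (fun t => u t - v t) (L - M).
Proof.
move=> uL /(laplaceZ _ (-1)) /(laplaceD _ _ _ _ _ uL); rewrite mulN1r.
by move=> /laplace_eq; apply=> t _; rewrite mulN1r.
Qed.

Lemma laplace0 a : is_laplace a (fun=> 0) 0.
Proof.
exists (fun=> 0); split=> //; last exact: cvg_cst.
by apply: der0_ext (der0_cst 0) _ => t _; rewrite mulr0.
Qed.

Lemma laplace_sum (I : Type) (s : seq I) a (u : I -> R -> R) (L : I -> R) :
  (forall i, is_laplace a (u i) (L i)) ->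
  is_laplace a (fun t => \sum_(i <- s) u i t) (\sum_(i <- s) L i).
Proof.
move=> uL; elim: s => [|i s ih].
  by rewrite big_nil; apply: laplace_eq (laplace0 a) _ => t _; rewrite big_nil.
rewrite big_cons; apply: laplace_eq (laplaceD _ _ _ _ _ (uL i) ih) _ => t _.
by rewrite big_cons.
Qed.

Lemma laplace_expR a c : 0 < a + c -> is_laplace a (fun t => expR (- c * t)) (a + c)^-1.
Proof.
move=> ac0; exists (fun t => (a + c)^-1 * (1 - expR (- (a + c) * t))); split.
- by rewrite mulr0 expR0 subrr mulr0.
- apply: der0_ext; first by apply: der0Z; apply: der0B (der0_cst 1) (der0_expR _).
  move=> t _ /=; rewrite sub0r -mulNr opprK mulrA mulVf ?gt_eqF// mul1r -expRD.
  by congr expR; ring.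
- rewrite -[X in _ --> X]mulr1 -[X in _ * X]subr0; apply: cvgM; first exact: cvg_cst.
  by apply: cvgB; [exact: cvg_cst|exact: expR_nat_cvg0].
Qed.

Lemma laplace_cst a c : 0 < a -> is_laplace a (fun=> c) (c / a).
Proof.
move=> a0; have /laplace_expR : 0 < a + 0 by rewrite addr0.
move=> /(laplaceZ _ c); rewrite addr0 => /laplace_eq; apply => t _.
by rewrite oppr0 mul0r expR0 mulr1.
Qed.

Lemma laplace_der0 a u g L M : 0 < a -> der0 u g -> (forall t, 0 <= t -> `|u t| <= M) ->
  is_laplace a u L -> is_laplace a g (a * L - u 0).
Proof.
move=> a0 ug uM [A [A0 dA AL]].
exists (fun t => a * A t + (expR (- a * t) * u t - u 0)); split.
- by rewrite A0 !mulr0 expR0 mul1r subrr addr0.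
- apply: der0_ext.
    apply: der0D (der0Z a _ _ dA) _.
    by apply: der0B (der0_cst (u 0)); apply: der0M (der0_expR _) ug.
  by move=> t _ /=; ring.
- apply: cvgD; first by apply: cvgM => //; exact: cvg_cst.
  rewrite -[X in _ --> X]add0r; apply: cvgB; last exact: cvg_cst.
  have eM : expR (- a * n%:R) * M @[n --> \oo] --> (0 : R).
    rewrite -[X in _ --> X](mul0r M); apply: cvgM (cvg_cst _).
    exact: expR_nat_cvg0.
  have eN : - (expR (- a * n%:R) * M) @[n --> \oo] --> (0 : R).
    by rewrite -[X in _ --> X]oppr0; exact: cvgN.
  apply: squeeze_cvgr eN eM; near=> n.
  by rewrite -ler_norml normrM ger0_norm ?expR_ge0// ler_wpM2l ?expR_ge0// uM.
Unshelve. all: by end_near. Qed.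

Lemma laplace_le a u v L M : (forall t, 0 < t -> u t <= v t) ->
  is_laplace a u L -> is_laplace a v M -> L <= M.
Proof.
move=> uv uL vM; rewrite -subr_ge0.
have [A [A0 dA AL]] := laplaceB _ _ _ _ _ vM uL.
apply: (cvgr_to_ge AL); apply: nearW => n; rewrite -A0.
apply: (der0_nondecreasing _ _ n%:R dA) => // t t0 _.
by rewrite mulr_ge0 ?expR_ge0// subr_ge0 uv.
Qed.

Lemma laplace_unique a u L M : is_laplace a u L -> is_laplace a u M -> L = M.
Proof. by move=> uL uM; apply/eqP; rewrite eq_le !(laplace_le a u u). Qed.

Lemma laplace_antiderivative_le a u (A : R -> R) L t : A n%:R @[n --> \oo] --> L ->
  der0 A (fun t => expR (- a * t) * u t) -> (forall t, 0 < t -> 0 <= u t) ->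
  0 <= t -> A t <= L.
Proof.
move=> AL dA u0 t0; apply: (cvgr_to_ge AL); exists (Num.truncn t).+1 => // n /= tn.
apply: (der0_nondecreasing _ _ n%:R dA) => //.
  by move=> s s0 _; rewrite mulr_ge0 ?expR_ge0// u0.
by apply: ltW; apply: lt_le_trans (truncnS_gt t) _; rewrite ler_nat.
Qed.

Lemma laplace_exists a u g : 0 < a -> der0 u g ->
  (forall t, 0 <= t -> 0 <= u t <= 1) -> exists L, is_laplace a u L.
Proof.
move=> a0 ug u01; have dv := der0M _ _ _ _ (der0_expR (- a)) ug.
have [t t0||A A0 dA] := der0_antiderivative (fun t => expR (- a * t) * u t).
- exact: der0_cont dv t0.
- by case: dv.
have [B [B0 dB BL]] := laplace_cst a 1 a0.
have AB t : 0 <= t -> A t <= B t.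
  move=> t0; have := der0_nondecreasing _ _ t (der0B _ _ _ _ dB dA) _ 0 t (lexx _) t0.
  rewrite A0 B0 subrr subr_ge0; apply=> // s s0 _.
  by rewrite subr_ge0 ler_wpM2l ?expR_ge0//; have /andP[] := u01 s (ltW s0).
have ndA : nondecreasing_seq (fun n => A n%:R).
  move=> m n mn; apply: (der0_nondecreasing _ _ n%:R dA) => //; last by rewrite ler_nat.
  by move=> s s0 _; rewrite mulr_ge0 ?expR_ge0//; have /andP[] := u01 s (ltW s0).
exists (limn (fun n => A n%:R)); exists A; split=> //.
apply: nondecreasing_is_cvgn => //; exists (1 / a) => _ [n _ <-].
apply: le_trans (AB _ (ler0n _ n)) _.
exact: laplace_antiderivative_le BL dB _ _.
Qed.

(** The density [a * expR (- a * t)] moves its mass to infinity as [a] tends to [0]. *)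
Lemma laplace_abel u l : (forall t, 0 <= t -> 0 <= u t <= 1) -> u t @[t --> +oo] --> l ->
  forall e : R, 0 < e -> exists2 d : R, 0 < d &
    forall a L, 0 < a -> a < d -> is_laplace a u L -> `|a * L - l| <= e.
Proof.
move=> u01 ul e e0.
have e20 : 0 < e / 2 by rewrite divr_gt0.
have /cvgrPdist_le /(_ _ e20) [T0 [_ hT0]] := ul.
pose T := Num.max T0 0 + 1.
have T1 : 0 < T by rewrite ltr_wpDl// le_max lexx orbT.
have hT t : T <= t -> `|l - u t| <= e / 2.
  by move=> Tt; apply: hT0; apply: lt_le_trans Tt; rewrite ltr_pwDr// le_max lexx.
have l01 : 0 <= l <= 1.
  apply/andP; split; [apply: (cvgr_to_ge ul)|apply: (cvgr_to_le ul)];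
    near=> t; have /andP[] // : 0 <= u t <= 1;
    by apply: u01; near: t; exact: nbhs_pinfty_ge.
pose k := expR 1 * T : R.
have k0 : 0 < k by rewrite mulr_gt0 ?expR_gt0.
(* The comparison function below contributes [a * expR 1 / (a + T^-1)], which is at most [a * k]. *)
exists (e / 2 / k); first by rewrite divr_gt0.
move=> a L a0 ad uL.
have aT0 : 0 < a + T^-1 by rewrite addr_gt0 ?invr_gt0.
(* The indicator of [0, T] is below [expR (1 - t / T)]. *)
have cmp (s : R) (t : R) : `|s| = 1 -> 0 < t ->
    s * (u t - l) <= e / 2 + expR 1 * expR (- T^-1 * t).
  move=> s1 t0; apply: le_trans (ler_norm _) _; rewrite normrM s1 mul1r.
  have [tT|Tt] := leP t T; last first.
    by rewrite distrC (le_trans (hT _ (ltW Tt)))// lerDl mulr_ge0 ?expR_ge0.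
  apply: (@le_trans _ _ 1).
    by have := u01 _ (ltW t0); rewrite ler_norml; move: l01; lra.
  rewrite -[X in X <= _]add0r lerD ?(ltW e20)// -expRD.
  apply: le_trans (expR_ge1Dx _); rewrite lerDl.
  by rewrite mulNr subr_ge0 mulrC ler_pdivrMr// mul1r.
have bound (s : R) : `|s| = 1 -> s * (a * L - l) <= e.
  move=> s1.
  have h1 := laplaceZ _ s _ _ (laplaceB _ _ _ _ _ uL (laplace_cst a l a0)).
  have h2 := laplaceD _ _ _ _ _ (laplace_cst a (e / 2) a0)
    (laplaceZ _ (expR 1) _ _ (laplace_expR a T^-1 aT0)).
  have := laplace_le _ _ _ _ _ (fun t => cmp s t s1) h1 h2.
  rewrite -(ler_pM2l a0).
  have -> : a * (s * (L - l / a)) = s * (a * L - l) by field; rewrite gt_eqF.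
  move=> /le_trans; apply.
  have -> : a * (e / 2 / a + expR 1 / (a + T^-1)) = e / 2 + a * (expR 1 / (a + T^-1)).
    by field; rewrite !gt_eqF// ltr_pwDl// mulr_gt0.
  rewrite [leRHS]splitr lerD2l; apply: (@le_trans _ _ (a * k)).
    rewrite ler_pM2l// /k ler_pM2l ?expR_gt0// -[leRHS]invrK.
    by rewrite lef_pV2 ?posrE// ?invr_gt0// lerDr ltW.
  by rewrite -ler_pdivlMr// ltW.
rewrite ler_norml -[X in X && _]lerN2 opprK -mulN1r bound ?normrN1//=.
by rewrite -[X in X <= _]mul1r bound// normr1.
Unshelve. all: by end_near. Qed.

Lemma laplace_generator a (lambda mu : R) (u : tree -> R -> R) (L : tree -> R) x :
  (forall y, is_laplace a (u y) (L y)) ->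
  is_laplace a (fun t => generator lambda mu (u^~ t) x) (generator lambda mu L x).
Proof.
move=> uL; apply: laplaceD; apply: laplaceZ; apply: laplace_sum => y;
  exact: laplaceB.
Qed.

End Laplace.

(** * The renewal equation *)

Lemma der0_expR_comp {R : realType} (u g : R -> R) : der0 u g ->
  der0 (fun t => expR (u t)) (fun t => g t * expR (u t)).
Proof.
move=> [ug u0]; split=> [t t0|].
  have := ug _ t0 => h; have /= := is_derive1_comp (is_derive_expR (u t)) h.
  by rewrite mulrC.
by apply: continuous_cvg => //; exact: continuous_expR.
Qed.

Section LaplaceSurvival.
Context {R : realType} (lambda mu : R) (p : R -> tree -> tree -> R).
Hypotheses (lambda0 : 0 < lambda) (mu0 : 0 < mu).
Hypotheses (tp : transition_function p) (rp : has_rates p (tree_rate lambda mu)).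

(** The function [expR (a * t) * E x] solves the backward equation. Adding [M] makes it nonnegative
    at time [0], hence always; dividing by [expR (a * t)] and letting [t] grow leaves [E >= 0], and
    likewise for [- E]. *)
Lemma resolvent_unique (a M : R) (E : tree -> R) : 0 < a -> (forall x, `|E x| <= M) ->
  (forall x, a * E x = generator lambda mu E x) -> forall x, E x = 0.
Proof.
move=> a0 EM aE.
have kappa0 : 0 < lambda + mu by rewrite addr_gt0.
have ge0 (e : R) x : `|e| = 1 -> 0 <= e * E x.
  move=> e1; have M0 : 0 <= M by apply: le_trans (EM x).
  have eEM y : `|e * E y| <= M by rewrite normrM e1 mul1r.
  have key t : 0 <= t -> 0 <= e * expR (a * t) * E x + M.
    apply: (@supersolution_ge0 _ _ tree_size _ kappa0
      (fun y t => e * expR (a * t) * E y + M) (fun y t => a * (e * expR (a * t) * E y))).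
    - move=> y; apply: der0_ext; first apply: der0D (der0_cst M).
        by apply: der0M (der0_cst (E y)); apply: der0Z; exact: der0_expR.
      by move=> s _ /=; ring.
    - move=> y s m s0 m0 H.
      have -> : a * (e * expR (a * s) * E y) =
          generator lambda mu (fun w => e * expR (a * s) * E w + M) y.
        rewrite mulrCA aE -generatorZ /generator; congr (_ * _ + _ * _);
          apply: eq_bigr => w _; ring.
      exact: generator_ge.
    - move=> y; rewrite mulr0 expR0 mulr1 -lerBlDr sub0r.
      by have := eEM y; rewrite ler_norml => /andP[].
    - move=> T; exists (expR (a * T) * M) => y s s0 sT.
      apply: (@le_trans _ _ (e * expR (a * s) * E y)); last by rewrite lerDl.
      rewrite lerNl -mulrN; apply: le_trans (ler_norm _) _.
      rewrite mulrAC normrM mulrN normrN (ger0_norm (expR_ge0 (a * s))) mulrC.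
      apply: ler_pM => //.
      by rewrite ler_expR ler_pM2l.
  have lim : - (expR (- a * n%:R) * M) @[n --> \oo] --> (0 : R).
    rewrite [X in _ --> X](_ : 0 = - (0 * M)); last by rewrite mul0r oppr0.
    by apply: cvgN; apply: cvgM (cvg_cst _); exact: expR_nat_cvg0.
  apply: (cvgr_to_le lim); apply: nearW => n.
  have := mulr_ge0 (expR_ge0 (- a * n%:R)) (key n%:R (ler0n _ n)).
  rewrite [X in 0 <= X](_ : _ = e * E x * (expR (- a * n%:R) * expR (a * n%:R)) +
    expR (- a * n%:R) * M); last by ring.
  by rewrite -expRD mulNr addNr expR0 mulr1 -lerBlDr sub0r.
move=> x; apply/eqP; rewrite eq_le -oppr_ge0 -mulN1r ge0 ?normrN1//=.
by rewrite -[E x]mul1r ge0// normr1.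
Qed.

Definition height_ge (h : nat) (x : tree) : R := 1 - (height x < h)%:R.

Lemma height_ge01 h : unit_valued (height_ge h).
Proof.
by move=> x; rewrite /height_ge subr_ge0 gerBl ler0n lern1 leq_b1.
Qed.

Lemma height_le0 x : height_le 0 x = (x == single_vertex)%:R :> R.
Proof.
rewrite /height_le; case: x => -[|c cs]; first by rewrite eqxx.
by rewrite height_cons leqn0 /= gtn_eqF ?leq_max// (_ : _ == _ = false)//; apply/eqP.
Qed.

Lemma laplace_semigroup (a : R) (f : tree -> R) : 0 < a -> unit_valued f ->
  exists U : tree -> R, [/\ forall x, is_laplace a (fun t => semigroup p f t x) (U x),
    forall x, 0 <= U x <= 1 / a
  & forall x, a * U x - f x = generator lambda mu U x].
Proof.
move=> a0 f01; have d x := semigroup_der0 lambda mu p tp rp f x f01.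
have u01 x t : 0 <= t -> 0 <= semigroup p f t x <= 1.
  by move=> t0; exact: unit_valued_semigroup p tp f t f01 t0 x.
have [U hU] := choice (fun x => laplace_exists a _ _ a0 (d x) (u01 x)).
exists U; split=> // x.
  apply/andP; split.
    apply: laplace_le (laplace0 a) (hU x) => t t0.
    by have /andP[] := u01 x t (ltW t0).
  apply: laplace_le (hU x) (laplace_cst a 1 a0) => t t0.
  by have /andP[] := u01 x t (ltW t0).
apply: laplace_unique (laplace_generator a lambda mu _ _ x hU).
rewrite -[X in _ - X](semigroup0 p tp f x f01).
apply: (laplace_der0 a _ _ _ 1 a0 (d x)) (hU x) => t t0.
by have /andP[? ?] := u01 x t t0; rewrite ger0_norm.
Qed.

(** The resolvent equation with killing at rate [mu] in the single vertex: a deleted subtree has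
    value [0]. *)
Lemma laplace_subtree_survival (a : R) h : 0 < a ->
  exists L : tree -> R, [/\ forall c, is_laplace a (subtree_survival p h c) (L c),
    forall c, 0 <= L c <= 1 / a
  & forall c, a * L c - height_ge h c =
      generator lambda mu L c - mu * (c == single_vertex)%:R * L single_vertex].
Proof.
move=> a0; have d c := subtree_survival_der0 lambda mu p lambda0 mu0 tp rp h c.
have u01 c t : 0 <= t -> 0 <= subtree_survival p h c t <= 1.
  move=> t0; rewrite (subtree_survival_ge0 lambda mu)//.
  exact: (subtree_survival_le1 lambda mu p lambda0 tp rp).
have [L hL] := choice (fun x => laplace_exists a _ _ a0 (d x) (u01 x)).
exists L; split=> // c.
  apply/andP; split.
    apply: laplace_le (laplace0 a) (hL c) => t t0.
    by have /andP[] := u01 c t (ltW t0).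
  apply: laplace_le (hL c) (laplace_cst a 1 a0) => t t0.
  by have /andP[] := u01 c t (ltW t0).
have <- : subtree_survival p h c 0 = height_ge h c.
  exact: subtree_survival0 tp h c.
have h1 : is_laplace a (fun t => subtree_generator lambda mu
    (fun o => if o is Some d then subtree_survival p h d t else 0) c)
    (a * L c - subtree_survival p h c 0).
  apply: (laplace_der0 a _ _ _ 1 a0 (d c)) (hL c) => t t0.
  by have /andP[? ?] := u01 c t t0; rewrite ger0_norm.
apply: (laplace_unique _ _ _ _ h1).
apply: laplace_eq (laplaceB _ _ _ _ _ (laplace_generator a lambda mu _ _ c hL)
  (laplaceZ a (mu * (c == single_vertex)%:R) _ _ (hL single_vertex))) _ => t _.
rewrite /subtree_generator /=; case: eqP => [->|_]; last by rewrite !mulr0 !mul0r subr0 addr0.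
by rewrite sub0r mulrN.
Qed.

(* The Laplace transform of the renewal equation that expresses the survival of
   a subtree through the process itself, restarted whenever it is deleted. *)
Lemma laplace_renewal (a : R) h : 0 < a -> exists L U r,
  [/\ is_laplace a (subtree_survival p h single_vertex) L,
      is_laplace a (fun t => semigroup p (height_ge h) t single_vertex) U,
      is_laplace a (forest_cdf p 0 [::]) r,
      0 <= L <= 1 / a & L * (1 + mu * r) = U].
Proof.
move=> a0.
have [L [hL L01 eL]] := laplace_subtree_survival a h a0.
have [U [hU U01 eU]] := laplace_semigroup _ _ a0 (height_ge01 h).
have [r [hr r01 er]] := laplace_semigroup _ _ a0 (height_le01 (R := R) 0).
exists (L single_vertex), (U single_vertex), (r single_vertex).
suff E0 : forall x, L x - U x + mu * L single_vertex * r x = 0.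
  split=> //; first exact: hr. apply/eqP; rewrite -subr_eq0 -[X in _ == X](E0 single_vertex).
  by apply/eqP; ring.
(* The killing term in the equation of [L] is cancelled by the source term, located at the single
   vertex, in the equation of [r]. *)
pose E x := L x - U x + mu * L single_vertex * r x; rewrite -/E.
apply: (resolvent_unique a (1 / a + 1 / a + mu * (1 / a) * (1 / a)) _ a0) => x.
  apply: le_trans (ler_normD _ _) _; apply: lerD.
    apply: le_trans (ler_normB _ _) _; apply: lerD.
      by have /andP[? ?] := L01 x; rewrite ger0_norm.
    by have /andP[? ?] := U01 x; rewrite ger0_norm.
  have /andP[? ?] := L01 single_vertex; have /andP[? ?] := r01 x.
  rewrite ger0_norm ?mulr_ge0 ?(ltW mu0)//.
  by apply: ler_pM; rewrite ?mulr_ge0 ?(ltW mu0)// ler_pM2l.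
have -> : generator lambda mu E x = generator lambda mu L x - generator lambda mu U x
    + mu * L single_vertex * generator lambda mu r x.
  transitivity (generator lambda mu (fun x => L x - U x) x -
    generator lambda mu (fun x => - (mu * L single_vertex) * r x) x).
    by rewrite -generatorB; congr generator; apply/funext => y; rewrite /E; ring.
  rewrite (generatorB _ _ L U) generatorZ; ring.
have := eL x; have := eU x; have := er x; rewrite height_le0 => <- <- eLx.
have -> : generator lambda mu L x = a * L x - height_ge h x +
  mu * (x == single_vertex)%:R * L single_vertex by rewrite eLx subrK.
by rewrite /E; ring.
Qed.

Variables (h : nat) (a L : R).
Hypotheses (a0 : 0 < a) (zL : is_laplace a (subtree_survival p h single_vertex) L).
Local Notation V := (forest_cdf p h [::]).
Local Notation z := (subtree_survival p h single_vertex).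

Let z0 t : 0 < t -> 0 <= z t.
Proof. by move=> /ltW; exact: (subtree_survival_ge0 lambda mu). Qed.

Let V0 t : 0 < t -> 0 <= V t.
Proof. by move=> /ltW; exact: forest_cdf_ge0. Qed.

Let dV := forest_cdf_nil_der0 lambda mu p lambda0 tp rp h.

(** The derivative has the sign of [k * expR (- a * t) - 1]. The choice [k = 1] gives an upper bound
    of [V] at all times, and [k = expR (a * T)] a lower bound up to time [T]. *)
Lemma forest_cdf_expR_der0 (k : R) (A : R -> R) :
  der0 A (fun t => expR (- a * t) * z t) ->
  der0 (fun t => V t * expR (lambda * k * A t))
    (fun t => lambda * V t * z t * expR (lambda * k * A t) * (k * expR (- a * t) - 1)).
Proof.
move=> dA; apply: der0_ext.
  by apply: der0M dV _; apply: der0_expR_comp; apply: der0Z; exact: dA.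
by move=> t _ /=; ring.
Qed.

Lemma forest_cdf_nil0 : V 0 = 1.
Proof. by rewrite forest_cdf0. Qed.

Lemma forest_cdf_le_expR (A : R -> R) t : A 0 = 0 ->
  der0 A (fun t => expR (- a * t) * z t) -> 0 <= t -> V t <= expR (- (lambda * A t)).
Proof.
move=> A0 dA t0; have := der0N _ _ (forest_cdf_expR_der0 1 A dA).
move=> /der0_nondecreasing /(_ _ 0 t (lexx _) t0 (lexx _)) H.
rewrite expRN -[leRHS]mul1r ler_pdivlMr ?expR_gt0//.
have : - (V 0 * expR (lambda * 1 * A 0)) <= - (V t * expR (lambda * 1 * A t)).
  apply: H => s s0 _; rewrite oppr_ge0 mulr_ge0_le0//.
    by rewrite !mulr_ge0 ?expR_ge0 ?z0 ?V0// ltW.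
  by rewrite mul1r subr_le0 -[leRHS]expR0 ler_expR mulNr oppr_le0 mulr_ge0 ?ltW.
by rewrite lerN2 A0 mulr1 mulr0 expR0 mulr1 forest_cdf_nil0.
Qed.

Lemma forest_cdf_limit_le l : V t @[t --> +oo] --> l -> l <= expR (- (lambda * L)).
Proof.
move=> Vl; have [A [A0 dA AL]] := zL.
have h1 : V n%:R @[n --> \oo] --> l by apply: cvg_comp Vl; exact: cvgr_idn.
have h2 : expR (- (lambda * A n%:R)) @[n --> \oo] --> expR (- (lambda * L)).
  apply: continuous_cvg; first exact: continuous_expR.
  by apply: cvgN; apply: cvgM AL; exact: cvg_cst.
apply: (ler_cvg_to h1 h2); apply: nearW => n; exact: forest_cdf_le_expR.
Qed.

Lemma forest_cdf_ge_expR T : 0 <= T -> expR (- (lambda * (expR (a * T) * L))) <= V T.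
Proof.
move=> T0; have [A [A0 dA AL]] := zL.
have := forest_cdf_expR_der0 (expR (a * T)) A dA.
move=> /der0_nondecreasing /(_ _ 0 T (lexx _) T0 (lexx _)) H.
have : V 0 * expR (lambda * expR (a * T) * A 0) <= V T * expR (lambda * expR (a * T) * A T).
  apply: H => s s0 sT; rewrite mulr_ge0//.
    by rewrite !mulr_ge0 ?expR_ge0 ?z0 ?V0// ltW.
  rewrite subr_ge0 -expRD -[leLHS]expR0 ler_expR mulNr -mulrBr mulr_ge0 ?(ltW a0)//.
  by rewrite subr_ge0 ltW.
rewrite A0 mulr0 expR0 mulr1 forest_cdf_nil0 -ler_pdivrMr ?expR_gt0// mul1r -expRN.
apply: le_trans; rewrite ler_expR lerN2 -mulrA ler_pM2l// ler_pM2l ?expR_gt0//.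
exact: laplace_antiderivative_le AL dA z0 T0.
Qed.

(** Integrating by parts, [a * r] is [1] minus [lambda] times the integral of
    [expR (- a * t) * V t * z t]. Bounding [V] there by [expR (- (lambda * A t))] makes the
    integrand an exact derivative, whence the bound. *)
Lemma laplace_forest_cdf_ge r : is_laplace a V r -> expR (- (lambda * L)) <= a * r.
Proof.
move=> [B [B0 dB Br]]; have [A [A0 dA AL]] := zL.
have h1 : a * B n%:R + expR (- a * n%:R) * 1 @[n --> \oo] --> a * r + 0 * 1.
  apply: cvgD; first by apply: cvgM Br; exact: cvg_cst.
  by apply: cvgM (cvg_cst _); exact: expR_nat_cvg0.
have h2 : expR (- (lambda * A n%:R)) @[n --> \oo] --> expR (- (lambda * L)).
  apply: continuous_cvg; first exact: continuous_expR.
  by apply: cvgN; apply: cvgM AL; exact: cvg_cst.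
rewrite -[a * r]addr0 -[X in _ + X](mul0r 1); apply: (ler_cvg_to h2 h1).
apply: nearW => n.
apply: (@le_trans _ _ (a * B n%:R + expR (- a * n%:R) * V n%:R)); last first.
  by rewrite lerD2l ler_wpM2l ?expR_ge0// forest_cdf_le1.
have := der0B _ _ _ _ (der0D _ _ _ _ (der0Z a _ _ dB) (der0M _ _ _ _ (der0_expR (- a)) dV))
  (der0_expR_comp _ _ (der0N _ _ (der0Z lambda _ _ dA))).
move=> /der0_nondecreasing /(_ _ 0 n%:R (lexx _) (ler0n _ n) (lexx _)).
rewrite B0 A0 !mulr0 expR0 oppr0 expR0 forest_cdf_nil0 mulr1 add0r subrr subr_ge0.
apply=> s s0 _.
rewrite (_ : _ - _ = lambda * expR (- a * s) * z s * (expR (- (lambda * A s)) - V s)); last by ring.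
rewrite !mulr_ge0 ?expR_ge0 ?z0 ?(ltW lambda0)// subr_ge0.
exact: forest_cdf_le_expR A0 dA (ltW s0).
Qed.

End LaplaceSurvival.

(** * The law of the process *)

Section CountableLaw.
Context {R : realType} (d : measure_display) (T : measurableType d) (P : probability T R).

Lemma measurable_countable_law (S : countType) (X : T -> S) (A : set S) :
  (forall y, measurable [set w | X w = y]) -> measurable [set w | A (X w)].
Proof.
move=> mX; have -> : [set w | A (X w)] = \bigcup_y ([set w | X w = y] `&` [set w | A y]).
  by apply/seteqP; split=> [w Aw|w [y _ [/= <-]]]//; exists (X w).
apply: countable_bigcupT_measurable => [|y]; first exact: countableP.
apply: measurableI => //; case: (pselect (A y)) => Ay.
  by rewrite (_ : [set _ | _] = setT)//; apply/seteqP; split=> w.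
by rewrite (_ : [set _ | _] = set0)//; apply/seteqP; split=> w.
Qed.

(** Finite additivity gives one inequality for [A] and for its complement; as the total masses
    agree, both are equalities. *)
Lemma countable_law (S : countType) (X : T -> S) (q : S -> R) (A : set S) :
  (forall y, measurable [set w | X w = y]) ->
  (forall y, P [set w | X w = y] = (q y)%:E) ->
  (\esum_(y in [set: S]) (q y)%:E = 1)%E ->
  (P [set w | A (X w)] = \esum_(y in A) (q y)%:E)%E.
Proof.
move=> mX Pq q1.
have q0 y : (0 <= (q y)%:E)%E by rewrite -Pq.
have le B : (\esum_(y in B) (q y)%:E <= P [set w | B (X w)])%E.
  apply: ge_ereal_sup => _ [F [fF FB] <-].
  under eq_fsbigr do rewrite -Pq.
  rewrite -measure_fin_bigcup//; last first.
    by move=> i j _ _ [w [/= <- <-]].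
  apply: le_measure; rewrite ?inE.
  - exact: fin_bigcup_measurable.
  - exact: measurable_countable_law.
  - by move=> w [y /FB By /= ->].
apply/eqP; rewrite eq_le le andbT.
have := le (~` A); have mA := measurable_countable_law _ _ A mX.
rewrite (_ : [set w | (~` A) (X w)] = ~` [set w | A (X w)])// probability_setC//.
have := q1; rewrite (esumID A)// !setTI.
have fA := fin_num_measure P _ mA.
have [a0 b0] : (0 <= \esum_(y in A) (q y)%:E)%E /\ (0 <= \esum_(y in ~` A) (q y)%:E)%E.
  by split; apply: esum_ge0.
rewrite -(fineK fA); move: (fine _) a0 b0 => c.
case: (esum A _) => [a||]//; case: (esum (~` A) _) => [b||]// _ _.
by rewrite -EFinD => -[ab]; rewrite -EFinB !lee_fin; lra.
Qed.

Lemma nat_law_le (X : T -> nat) (h : nat) : (forall k, measurable [set w | X w = k]) ->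
  fine (P [set w | (X w <= h)%N]) = \sum_(k < h.+1) fine (P [set w | X w = k]).
Proof.
move=> mX; have -> : [set w | (X w <= h)%N] = \big[setU/set0]_(k < h.+1) [set w | X w = k].
  rewrite -(bigcup_mkord h.+1 (fun k => [set w | X w = k])).
  apply/seteqP; split=> [w Xw|w [k /= kh Xk]]; last by rewrite /= Xk -ltnS.
  by exists (X w).
rewrite measure_bigsetU_ord//; last first.
  by move=> i j _ _ [w [/= Xi Xj]]; apply: val_inj; rewrite /= -Xi -Xj.
by rewrite sum_fine// => i _; exact: fin_num_measure.
Qed.

Lemma nat_tail (X : T -> nat) (h : nat) : (forall k, measurable [set w | X w = k]) ->
  fine (P [set w | (h < X w)%N]) = 1 - fine (P [set w | (X w <= h)%N]).
Proof.
move=> mX; have mA : measurable [set w | (X w <= h)%N].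
  exact: (measurable_countable_law _ _ [set k | (k <= h)%N] mX).
have -> : [set w | (h < X w)%N] = ~` [set w | (X w <= h)%N].
  by apply/seteqP; split=> w /=; [move=> hX; rewrite leqNgt hX|move=> /negP; rewrite -ltnNge].
by rewrite probability_setC// fineB ?fin_num_measure.
Qed.

End CountableLaw.

Section ProcessLaw.
Context {R : realType} (d : measure_display) (T : measurableType d).
Context (P : probability T R) (G : R -> T -> tree) (p : R -> tree -> tree -> R).
Hypotheses (tp : transition_function p) (mG : markov_process P G p single_vertex).

Lemma process_law t y : 0 <= t -> P [set w | G t w = y] = (p t single_vertex y)%:E.
Proof.
move=> t0; have [meas P0 markov] := mG.
have := markov 0%N (fun i => if i is 0%N then 0 else t)
  (fun i => if i is 0%N then single_vertex else y) (lexx _).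
have mono : {homo (fun i => if i is 0%N then 0 else t) : i j / (i <= j)%N >-> i <= j}.
  by case=> [|i] [|j].
move=> /(_ mono) /=; rewrite subr0.
have -> : [set w | forall i, (i <= 0)%N -> G (match i with 0%N => 0 | _.+1 => t end) w =
    match i with 0%N => single_vertex | _.+1 => y end] = [set w | G 0 w = single_vertex].
  apply/seteqP; split=> [w /= Gw|w /= Gw i]; first exact: (Gw 0%N).
  by rewrite leqn0 => /eqP->.
rewrite P0 mul1e => <-.
have -> : [set w | forall i, (i <= 1)%N -> G (match i with 0%N => 0 | _.+1 => t end) w =
    match i with 0%N => single_vertex | _.+1 => y end] =
    [set w | G t w = y] `&` [set w | G 0 w = single_vertex].
  apply/seteqP; split=> [w /= Gw|w /= [Gt G0] [|[|i]]//].
  by split; [exact: (Gw 1%N)|exact: (Gw 0%N)].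
set A := [set w | _ = y]; set C := [set w | _ = single_vertex].
have mA : measurable A by exact: meas.
have mC : measurable C by exact: meas.
rewrite [LHS](measureDI _ mA mC) [X in (X + _)%E](_ : _ = 0)%E ?add0e//.
apply/eqP; rewrite eq_le measure_ge0 andbT.
apply: (@le_trans _ _ (P (~` C))).
  by apply: le_measure; rewrite ?inE; [exact: measurableD|exact: measurableC|move=> w []].
by rewrite probability_setC// P0 subee.
Qed.

Lemma forest_cdf_process h t : 0 <= t ->
  forest_cdf p h [::] t = \sum_(k < h.+1) fine (P [set w | height (G t w) = k]).
Proof.
move=> t0; have [meas _ _] := mG; have mGt y : measurable [set w | G t w = y] by exact: meas.
rewrite -(nat_law_le _ _ P (fun w => height (G t w))); last first.
  by move=> k; exact: (measurable_countable_law _ _ _ _ [set y | height y = k] mGt).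
rewrite (countable_law _ _ P _ _ (p t single_vertex) [set y | (height y <= h)%N] mGt).
- rewrite /forest_cdf /semigroup; congr fine; rewrite [RHS]esum_mkcond.
  apply: eq_esum => y _; rewrite /height_le; case: (boolP (height y <= h)%N) => hy.
    by rewrite mem_set// mulr1.
  by rewrite memNset ?mulr0//; exact/negP.
- by move=> y; exact: process_law.
- by case: tp => _ p1 _ _; exact: p1.
Qed.

End ProcessLaw.

(** * The stationary height *)

Section StationaryHeight.
Context {R : realType} (lambda mu : R) (p : R -> tree -> tree -> R).
Hypotheses (lambda0 : 0 < lambda) (mu0 : 0 < mu).
Hypotheses (tp : transition_function p) (rp : has_rates p (tree_rate lambda mu)).

Local Notation z h := (subtree_survival p h single_vertex).
Local Notation V h := (forest_cdf p h [::]).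

Lemma semigroup_compl (f : tree -> R) t x : unit_valued f -> 0 <= t ->
  semigroup p (fun y => 1 - f y) t x = 1 - semigroup p f t x.
Proof.
move=> f01 t0; have f'01 : unit_valued (fun y => 1 - f y).
  by move=> y; have := f01 y; lra.
case: (tp) => p0 p1 _ _.
have e : ((\esum_(y in [set: tree]) (p t x y * (1 - f y))%:E) +
    (\esum_(y in [set: tree]) (p t x y * f y)%:E) = 1)%E.
  have h1 y : [set: tree] y -> (0 <= (p t x y * (1 - f y))%:E)%E.
    by move=> _; rewrite lee_fin (semigroup_term_ge0 p tp _ _ x y f'01).
  have h2 y : [set: tree] y -> (0 <= (p t x y * f y)%:E)%E.
    by move=> _; rewrite lee_fin (semigroup_term_ge0 p tp _ _ x y f01).
  rewrite -(esumD h1 h2).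
  by rewrite -(p1 t x t0); apply: eq_esum => y _; rewrite -EFinD; congr EFin; ring.
move: e; rewrite -(semigroupE p tp _ t x f01 t0) -(semigroupE p tp _ t x f'01 t0) -EFinD.
by move=> /(congr1 fine) /= e; rewrite -[X in _ = X - _]e addrK.
Qed.

(** For a distribution function [l] of the height, the probability of a height at least [h], which
    is certain for [h = 0]. *)
Definition previous_tail (l : nat -> R) (h : nat) : R := if h is k.+1 then 1 - l k else 1.

Lemma semigroup_height_ge h t : 0 <= t -> semigroup p (height_ge h) t single_vertex =
  previous_tail (fun k => V k t) h.
Proof.
move=> t0; case: h => [|h] /=; last by rewrite -semigroup_compl//; exact: height_le01.
have f0 : unit_valued (fun _ : tree => 0 : R) by move=> y; rewrite lexx ler01.
rewrite (_ : height_ge 0 = fun y => 1 - 0); last first.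
  by apply/funext => y; rewrite /height_ge ltn0.
rewrite semigroup_compl// /semigroup esum1 ?subr0// => y _.
by rewrite mulr0.
Qed.

(** Half of the decay, [expR (- (c / 2) * t)], absorbs the factor [t] coming from the difference of
    the exponentials at the cost of [2 / c]; integrating the other half costs another [2 / c]. *)
Lemma laplace_Lipschitz (u : R -> R) (a b c La Lb : R) : 0 < c -> c <= b -> b <= a ->
  (forall t, 0 < t -> 0 <= u t <= 1) -> is_laplace a u La -> is_laplace b u Lb ->
  `|Lb - La| <= 4 / c ^+ 2 * (a - b).
Proof.
move=> c0 cb ba u01.
have c20 : 0 < c / 2 by rewrite divr_gt0.
have shift (k L : R) : is_laplace k u L ->
    is_laplace (c / 2) (fun t => expR (- (k - c / 2) * t) * u t) L.
  move=> [A [A0 dA AL]]; exists A; split=> //; apply: der0_ext dA _ => t _.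
  by rewrite mulrA -expRD; congr (expR _ * _); ring.
move=> /shift La' /shift Lb'; have D := laplaceB _ _ _ _ _ Lb' La'.
have e t : expR (- (b - c / 2) * t) * u t - expR (- (a - c / 2) * t) * u t =
    expR (- (b - c / 2) * t) * (1 - expR (- (a - b) * t)) * u t.
  rewrite (_ : - (a - c / 2) * t = - (b - c / 2) * t + - (a - b) * t); last by ring.
  by rewrite expRD; ring.
have ge0 t : 0 < t -> 0 <= 1 - expR (- (a - b) * t).
  move=> t0; rewrite subr_ge0 -[leRHS]expR0 ler_expR mulNr oppr_le0.
  by rewrite mulr_ge0 ?subr_ge0// ltW.
rewrite ger0_norm; last first.
  apply: laplace_le (laplace0 _) D => t t0; rewrite e.
  by have /andP[u0 _] := u01 t t0; rewrite !mulr_ge0 ?expR_ge0 ?ge0.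
have -> : 4 / c ^+ 2 * (a - b) = 2 / c * (a - b) / (c / 2) by field; rewrite gt_eqF.
apply: laplace_le D (laplace_cst _ (2 / c * (a - b)) c20) => t t0; rewrite e.
have /andP[u0 u1] := u01 t t0.
apply: (@le_trans _ _ (expR (- (b - c / 2) * t) * (1 - expR (- (a - b) * t)) * 1)).
  by apply: ler_wpM2l => //; rewrite mulr_ge0 ?expR_ge0 ?ge0.
rewrite mulr1; apply: (@le_trans _ _ (expR (- (c / 2 * t)) * ((a - b) * t))).
  apply: ler_pM; rewrite ?expR_ge0 ?ge0//.
    rewrite ler_expR mulNr lerN2 ler_pM2r//; move: cb; lra.
  rewrite lerBlDr -lerBlDl; apply: le_trans (expR_ge1Dx _).
  by rewrite mulNr.
rewrite expRN ler_pdivrMl ?expR_gt0//.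
have h : c / 2 * t <= expR (c / 2 * t).
  by apply: le_trans (expR_ge1Dx _); rewrite lerDr.
have -> : (a - b) * t = 2 / c * (a - b) * (c / 2 * t) by field; rewrite gt_eqF.
by rewrite [leRHS]mulrC ler_wpM2l// mulr_ge0 ?subr_ge0// divr_ge0// ltW.
Qed.

Variables (r : R) (rP : smallest_root (lambda / mu) r).

Lemma smallest_root_gt0 : 0 < r.
Proof.
case: rP => _ e _; rewrite -(pmulr_lgt0 _ (expR_gt0 (- r))) e.
by rewrite divr_gt0.
Qed.

(* [lambda * L] never equals [r] and tends to [0] as [a] grows, so that it stays
   below [r] by continuity. *)
Lemma laplace_survival_lt (a L : R) : 0 < a -> is_laplace a (z 0) L -> lambda * L < r.
Proof.
move=> a0 zL; have r0 := smallest_root_gt0.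
have z01 t : 0 < t -> 0 <= z 0 t <= 1.
  move=> /ltW t0; rewrite (subtree_survival_ge0 lambda mu)//.
  exact: (subtree_survival_le1 lambda mu p lambda0 tp rp).
have ne (b M : R) : 0 < b -> is_laplace b (z 0) M -> M <= 1 / b /\ lambda * M != r.
  move=> b0 zM; have [M' [U [s [zM' hU hs /andP[M0 M1] e]]]] :=
    laplace_renewal lambda mu p lambda0 mu0 tp rp b 0 b0.
  have {}zM' := laplace_unique _ _ _ _ zM zM'; subst M'; split=> //.
  have UE : U = 1 / b.
    apply: laplace_unique hU _; apply: laplace_eq (laplace_cst b 1 b0) _ => t t0.
    by rewrite semigroup_height_ge// ltW.
  have := laplace_forest_cdf_ge lambda mu p lambda0 mu0 tp rp 0 b M b0 zM s hs.
  set x := expR _ => xs.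
  have Mb : M * (b + mu * (b * s)) = 1.
    rewrite [LHS](_ : _ = b * (M * (1 + mu * s))); last by ring.
    by rewrite e UE; field; rewrite gt_eqF.
  have M_gt0 : 0 < M.
    by rewrite lt0r M0 andbT; apply: contra_eq_neq Mb => ->; rewrite mul0r eq_sym oner_eq0.
  (* Strict because of the summand [b > 0]; with [x * expR (- x)] in place of the left side this
     reads [x * expR (- x) < rho] at [x = lambda * M]. *)
  have lt1 : M * (mu * x) < 1.
    rewrite -Mb ltr_pM2l// ltr_pwDl// ler_pM2l//.
  apply/eqP => xr; case: rP => _ er _.
  move: lt1; rewrite /x xr.
  have -> : M * (mu * expR (- r)) = mu / lambda * (lambda * M * expR (- r)).
    by field; rewrite gt_eqF.
  by rewrite xr er mulrA divfK ?gt_eqF// divff ?gt_eqF// ltxx.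
rewrite ltNge; apply/negP => rL.
have exL (b : R) : exists M, 0 < b -> is_laplace b (z 0) M.
  case: (ltP 0 b) => b0; last by exists 0.
  have [M [? [? [? _ _ _ _]]]] := laplace_renewal lambda mu p lambda0 mu0 tp rp b 0 b0.
  by exists M.
have [Lf hLf] := choice exL.
(* Freezing the variable below [a] makes [f] Lipschitz on the whole line. *)
pose f b := lambda * Lf (Num.max b a).
have mx0 (b : R) : 0 < Num.max b a by rewrite lt_max a0 orbT.
have lip b c : `|f b - f c| <= lambda * (4 / a ^+ 2) * `|b - c|.
  rewrite /f -mulrBr normrM gtr0_norm// -mulrA ler_pM2l//.
  apply: (@le_trans _ _ (4 / a ^+ 2 * `|Num.max b a - Num.max c a|)); last first.
    rewrite ler_wpM2l ?divr_ge0 ?exprn_ge0 ?(ltW a0)//.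
    rewrite /Num.max; case: ltP => ha; case: ltP => hb; rewrite ?subrr ?normr0//.
      by rewrite distrC [leRHS]distrC !ger0_norm; move: ha hb; lra.
    by rewrite !ger0_norm; move: ha hb; lra.
  have bm : a <= Num.max b a by rewrite le_max lexx orbT.
  have cm : a <= Num.max c a by rewrite le_max lexx orbT.
  have [cb|/ltW bc] := leP (Num.max c a) (Num.max b a).
    rewrite distrC [X in _ <= _ * X]ger0_norm ?subr_ge0//.
    exact: laplace_Lipschitz a0 cm cb z01 (hLf _ (mx0 b)) (hLf _ (mx0 c)).
  rewrite [X in _ <= _ * X]distrC [X in _ <= _ * X]ger0_norm ?subr_ge0//.
  exact: laplace_Lipschitz a0 bm bc z01 (hLf _ (mx0 c)) (hLf _ (mx0 b)).
have K0 : 0 < lambda * (4 / a ^+ 2) by rewrite mulr_gt0// divr_gt0// exprn_gt0.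
have cf : continuous f.
  move=> b; apply/cvgrPdist_lt => e e0; near=> c.
  apply: le_lt_trans (lip b c) _; rewrite -ltr_pdivlMl//.
  near: c; exists ((lambda * (4 / a ^+ 2))^-1 * e) => //=.
  by rewrite mulr_gt0// invr_gt0.
(* At [a1] the trivial bound [lambda * L <= lambda / a1] is already at most [r]. *)
pose a1 := a + lambda / r.
have aa1 : a <= a1 by rewrite lerDl divr_ge0// ltW.
have a10 : 0 < a1 by exact: lt_le_trans aa1.
have fa : r <= f a by rewrite /f maxxx (laplace_unique _ _ _ _ (hLf a a0) zL).
have fa1 : f a1 <= r.
  rewrite /f max_l//; have [+ _] := ne _ _ a10 (hLf _ a10).
  rewrite -(ler_pM2l lambda0) => /le_trans; apply.
  by rewrite mulrA mulr1 ler_pdivrMr// /a1 mulrDr mulrCA divff ?gt_eqF// mulr1 lerDr mulr_ge0// ltW.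
have [||c _ fc] := @IVT _ f a a1 r aa1.
- exact: continuous_subspaceT.
- by rewrite ge_min fa1 orbT /= le_max fa.
- by have [_] := ne _ _ (mx0 c) (hLf _ (mx0 c)); rewrite -/(f c) fc eqxx.
Unshelve. all: by end_near. Qed.

Variables (l : nat -> R) (Vl : forall h, V h t @[t --> +oo] --> l h).

Let nonneg_expR_lim (x : R -> R) (y T : R) : x a @[a --> 0^'+] --> y ->
  expR (- (lambda * (expR (a * T) * x a))) @[a --> 0^'+] --> expR (- (lambda * y)).
Proof.
move=> xy; apply: continuous_cvg; first exact: continuous_expR.
apply: cvgN; apply: cvgM; first exact: cvg_cst.
rewrite -[X in _ --> X]mul1r; apply: cvgM => //.
rewrite -expR0; apply: continuous_cvg; first exact: continuous_expR.
rewrite -[X in _ --> X](mul0r T); apply: cvgM (cvg_cst _).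
exact: cvg_at_right_filter.
Qed.

(** Inserting [lambda * L < r] in [forest_cdf_ge_expR], the Laplace variable tends to [0] at fixed
    [T], then [T] to infinity. Besides selecting the root, this gives [0 < l 0], by which
    [limit_cdf] divides. *)
Lemma limit_cdf0_ge : expR (- r) <= l 0.
Proof.
have [Lf hLf] : exists Lf : R -> R, forall a, 0 < a -> is_laplace a (z 0) (Lf a).
  have exL (b : R) : exists M, 0 < b -> is_laplace b (z 0) M.
    case: (ltP 0 b) => b0; last by exists 0.
    have [M [? [? [? _ _ _ _]]]] := laplace_renewal lambda mu p lambda0 mu0 tp rp b 0 b0.
    by exists M.
  by have [Lf hLf] := choice exL; exists Lf.
apply: (cvgr_to_ge (Vl 0)); near=> T.
have T0 : 0 <= T by near: T; exact: nbhs_pinfty_ge.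
have cst_lim : (fun _ : R => r / lambda) a @[a --> 0^'+] --> r / lambda by exact: cvg_cst.
have := nonneg_expR_lim _ _ T cst_lim.
rewrite [lambda * (r / lambda)]mulrC divfK ?gt_eqF// => lim; apply: (cvgr_to_le lim); near=> a.
have a0 : 0 < a by [].
apply: le_trans (forest_cdf_ge_expR lambda mu p lambda0 mu0 tp rp 0 a _ a0 (hLf _ a0) T T0).
rewrite ler_expR lerN2 ler_pM2l// ler_pM2l ?expR_gt0// ler_pdivlMr// mulrC.
exact: ltW (laplace_survival_lt a _ a0 (hLf _ a0)).
Unshelve. all: by end_near. Qed.

(** Multiplied by [a], the renewal equation yields the limit of the transform of [z h] at [0], and
    hence the total intensity of the subtrees that matter. The exponential bounds on both sides of
    [V h] then close up. *)
Lemma limit_cdf (h : nat) :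
  l h = expR (- (lambda * (previous_tail l h / (mu * l 0)))).
Proof.
have l0 : 0 < l 0 := lt_le_trans (expR_gt0 _) limit_cdf0_ge.
pose u t := semigroup p (height_ge h) t single_vertex.
have exF a : exists F : R * R * R, 0 < a -> [/\ is_laplace a (z h) F.1.1,
    is_laplace a u F.1.2, is_laplace a (V 0) F.2 & F.1.1 * (1 + mu * F.2) = F.1.2].
  case: (ltP 0 a) => a0; last by exists (0, 0, 0).
  have [L [U [s [hL hU hs _ e]]]] := laplace_renewal lambda mu p lambda0 mu0 tp rp a h a0.
  by exists (L, U, s).
have [F hF] := choice exF.
have V01 t : 0 <= t -> 0 <= V 0 t <= 1.
  by move=> t0; rewrite forest_cdf_ge0// forest_cdf_le1.
have u01 t : 0 <= t -> 0 <= u t <= 1.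
  by move=> t0; exact: unit_valued_semigroup p tp _ t (height_ge01 h) t0 _.
have ul : u t @[t --> +oo] --> previous_tail l h.
  apply: (@cvg_trans _ ((fun t => previous_tail (fun k => V k t) h) @ +oo)).
    apply: near_eq_cvg; near=> t; have t0 : 0 <= t by near: t; exact: nbhs_pinfty_ge.
    by rewrite /u semigroup_height_ge.
  by case: (h) => [|k] /=; [exact: cvg_cst|apply: cvgB; [exact: cvg_cst|exact: Vl]].
have abel (v : R -> R) (c : R) (w : R -> R) : (forall t, 0 <= t -> 0 <= v t <= 1) ->
    v t @[t --> +oo] --> c -> (forall a, 0 < a -> is_laplace a v (w a)) ->
    a * w a @[a --> 0^'+] --> c.
  move=> v01 vc vw; apply/cvgrPdist_le => e e0.
  have [d d0 hd] := laplace_abel v c v01 vc e e0.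
  near=> a; have a0 : 0 < a by [].
  have ad : a < d by near: a; exact: nbhs_right_lt.
  by rewrite distrC; apply: hd (vw _ a0).
have limU : a * (F a).1.2 @[a --> 0^'+] --> previous_tail l h.
  by apply: abel u01 ul _ => a a0; case: (hF a a0).
have limr : a * (F a).2 @[a --> 0^'+] --> l 0.
  by apply: abel V01 (Vl 0) _ => a a0; case: (hF a a0).
have limL : (F a).1.1 @[a --> 0^'+] --> previous_tail l h / (mu * l 0).
  apply: (@cvg_trans _ ((fun a => a * (F a).1.2 / (a + mu * (a * (F a).2))) @ 0^'+)).
    apply: near_eq_cvg; near=> a; have a0 : 0 < a by [].
    have [_ _ hs <-] := hF a a0.
    have s0 : 0 <= (F a).2.
      apply: laplace_le (laplace0 a) hs => t /ltW t0.
      by have /andP[] := V01 t t0.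
    rewrite (_ : a * _ = (F a).1.1 * (a + mu * (a * (F a).2))); last by ring.
    rewrite mulfK// gt_eqF// ltr_pwDl// !mulr_ge0// ltW//.
  apply: cvgM => //; apply: cvgV; first by rewrite gt_eqF// mulr_gt0.
  rewrite -[X in _ --> X]add0r; apply: cvgD; first exact: cvg_at_right_filter.
  by apply: cvgM => //; exact: cvg_cst.
apply/eqP; rewrite eq_le; apply/andP; split.
  have := nonneg_expR_lim _ _ 0 limL => lim; apply: (cvgr_to_ge lim); near=> a.
  have a0 : 0 < a by []; have [hL _ _ _] := hF a a0.
  rewrite mulr0 expR0 mul1r.
  exact: (forest_cdf_limit_le lambda mu p lambda0 mu0 tp rp h a _ a0 hL).
apply: (cvgr_to_ge (Vl h)); near=> T.
have T0 : 0 <= T by near: T; exact: nbhs_pinfty_ge.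
apply: (cvgr_to_le (nonneg_expR_lim _ _ T limL)); near=> a.
have a0 : 0 < a by []; have [hL _ _ _] := hF a a0.
exact: (forest_cdf_ge_expR lambda mu p lambda0 mu0 tp rp h a _ a0 hL T T0).
Unshelve. all: by end_near. Qed.

Lemma stationary_cdf :
  l 0 = expR (- r) /\ forall h, l h.+1 = expR (- (r * (1 - l h))).
Proof.
have l0 : 0 < l 0 := lt_le_trans (expR_gt0 _) limit_cdf0_ge.
pose s := lambda / (mu * l 0).
have ls : l 0 = expR (- s) by rewrite [LHS]limit_cdf /s /= mul1r.
(* The lower bound on [l 0] gives [s <= r]; the minimality of [r] among the roots gives the
   converse. *)
have sr : s = r.
  apply/eqP; rewrite eq_le; apply/andP; split.
    by have := limit_cdf0_ge; rewrite ls ler_expR lerN2.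
  case: rP => _ _; apply; rewrite -ls /s; field.
  by rewrite !gt_eqF.
split; first by rewrite ls sr.
move=> h; rewrite limit_cdf -sr /s /=; congr expR; congr (- _); ring.
Qed.

End StationaryHeight.

(** * The critical iteration *)

Section CriticalIteration.
Context {R : realType}.

Lemma expR_upper_bound (x : R) : 0 <= x -> expR (- x) <= 1 - x + x ^+ 2 / 2.
Proof.
move=> x0.
have d := der0B _ _ _ _ (der0D _ _ _ _ (der0Z (-1 : R) _ _ (der0_exprn 0))
  (der0Z 2^-1 _ _ (der0_exprn 1))) (der0_expR (-1)).
have := der0_nondecreasing _ _ x d _ 0 x (lexx _) x0 (lexx _).
rewrite !expr1 !mulr0 expR0 expr0n /= mulr0 mulN1r => H.
have {H} : 0 + 0 - 1 <= - x + 2^-1 * x ^+ 2 - expR (- x).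
  apply: H => t t0 _; have := expR_ge1Dx (- t); rewrite expr0 expr1 !mulN1r; lra.
by rewrite [_ / 2]mulrC; lra.
Qed.

(** This rational bound is sharp enough to produce the exact constant [1/2] in
    [inv_one_minus_expR_bounds]; the derivative of the difference is [1 - (1 - t) * expR t]. *)
Lemma expR_Pade_bound (x : R) : 0 <= x -> (2 - x) * expR x <= 2 + x.
Proof.
move=> x0.
have d := der0B _ _ _ _ (der0D _ _ _ _ (der0_cst (2 : R)) (der0_exprn 0))
  (der0M _ _ _ _ (der0B _ _ _ _ (der0_cst (2 : R)) (der0_exprn 0)) (der0_expR 1)).
have := der0_nondecreasing _ _ x d _ 0 x (lexx _) x0 (lexx _).
rewrite !expr1 !mul1r expR0 => H.
rewrite -subr_ge0; apply: le_trans (H _); first by rewrite addr0 subr0 mulr1 subrr.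
move=> t t0 _; rewrite expr0 expr1 mul1r mul1r.
have : (1 - t) * expR t <= 1.
  rewrite -ler_pdivlMr ?expR_gt0// mul1r -expRN; exact: expR_ge1Dx.
lra.
Qed.

Lemma inv_one_minus_expR_bounds (x : R) : 0 < x -> x <= 1 ->
  x^-1 + 2^-1 <= (1 - expR (- x))^-1 <= x^-1 + 2^-1 + x / 2.
Proof.
move=> x0 x1.
have e0 : 0 < 1 - expR (- x) by rewrite subr_gt0 expR_lt1 oppr_lt0.
apply/andP; split.
  rewrite -[leRHS]mul1r ler_pdivlMr//.
  have -> : (x^-1 + 2^-1) * (1 - expR (- x)) =
      (2 + x) * (1 - expR (- x)) / (2 * x) by field; rewrite gt_eqF.
  rewrite ler_pdivrMr ?mulr_gt0// mul1r.
  have := expR_Pade_bound x (ltW x0).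
  rewrite -(ler_pM2l (expR_gt0 (- x))) mulrCA -expRD addNr expR0 mulr1; lra.
rewrite -[leLHS]mul1r ler_pdivrMr//.
have h := expR_upper_bound x (ltW x0).
apply: (@le_trans _ _ ((x^-1 + 2^-1 + x / 2) * (x - x ^+ 2 / 2))); last first.
  by rewrite ler_wpM2l ?addr_ge0 ?divr_ge0 ?invr_ge0 ?(ltW x0)//; move: h; lra.
have -> : (x^-1 + 2^-1 + x / 2) * (x - x ^+ 2 / 2) = 1 + x ^+ 2 * (1 - x) / 4.
  by field; rewrite gt_eqF.
by rewrite lerDl divr_ge0// mulr_ge0 ?subr_ge0// exprn_ge0// ltW.
Qed.

Variable x : nat -> R.
Hypotheses (x_0 : x 0%N = 1 - expR (- 1)) (x_S : forall h, x h.+1 = 1 - expR (- x h)).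

Lemma critical_iteration_bounds h : 0 < x h <= 1.
Proof.
elim: h => [|h /andP[ih _]]; rewrite ?x_0 ?x_S subr_gt0 expR_lt1 oppr_lt0 gerBl expR_ge0 ?andbT//.
Qed.

Lemma critical_inverse_ge h : 1 + h%:R / 2 <= (x h)^-1.
Proof.
elim: h => [|h ih].
  have /andP[? ?] := critical_iteration_bounds 0.
  by rewrite mul0r addr0 -[leRHS]mul1r ler_pdivlMr// mul1r.
have /andP[x0 x1] := critical_iteration_bounds h.
have /andP[h1 _] := inv_one_minus_expR_bounds _ x0 x1.
rewrite x_S; apply: le_trans h1; rewrite -natr1; move: ih; lra.
Qed.

Lemma critical_inverse_le h : (x h)^-1 <= (x 0%N)^-1 + h%:R / 2 + ln h.+1%:R.
Proof.
elim: h => [|h ih]; first by rewrite mul0r addr0 ln1 addr0.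
have /andP[x0 x1] := critical_iteration_bounds h.
have /andP[_ h1] := inv_one_minus_expR_bounds _ x0 x1.
rewrite x_S; apply: le_trans h1 _.
(* The lower bound on the reciprocal turns the remainder into a harmonic term, and [ln (1 + u) <= u]
   at [u = - h.+2%:R^-1] sums these terms to a logarithm. *)
have h2 : x h / 2 <= h.+2%:R^-1.
  have := critical_inverse_ge h; rewrite -[leRHS]mul1r ler_pdivlMr// => h2.
  rewrite -[leRHS]mul1r ler_pdivlMr//.
  have -> : h.+2%:R = h%:R + 2 :> R by rewrite -natrD addn2.
  move: h2; lra.
have h3 : ln h.+1%:R + h.+2%:R^-1 <= ln h.+2%:R :> R.
  rewrite -lerBrDl -[leRHS]opprB -lerNr -ln_div ?posrE//.
  have -> : h.+1%:R / h.+2%:R = 1 + - h.+2%:R^-1 :> R.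
    have n0 : h.+2%:R != 0 :> R by rewrite pnatr_eq0.
    rewrite (_ : h.+1%:R = h.+2%:R - 1); last by rewrite -[h.+2%:R]natr1 addrK.
    by rewrite mulrBl divff// mul1r.
  by apply: le_ln1Dx; rewrite ltrN2 invf_lt1// ltr1n.
have e : h.+1%:R = h%:R + 1 :> R by rewrite natr1.
rewrite [in X in _ <= _ + X + _]e; move: (h.+2%:R^-1) (ln _) (ln _) ih h2 h3 => w u v.
lra.
Qed.

Lemma critical_iteration_asymptotics :
  (fun h : nat => x h - 2 / h%:R : R^o) =O_\oo
  (fun h : nat => ln h%:R / h%:R ^+ 2 : R^o).
Proof.
have l2 : 0 < ln 2 :> R by rewrite ln_gt0// ltr1n.
(* For [h >= 2], [y - h / 2] is at most [C / 4 * ln h]: the constant [(x 0)^-1] is absorbed through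
   [ln 2 <= ln h], and [ln h.+1] through [h.+1 <= h ^ 2]. The other factor [2 / (h * y)] is at most
   [4 / h ^ 2]. *)
pose C : R := 4 * ((x 0%N)^-1 / ln 2 + 2).
apply/eqOP; near=> k; near=> h.
have h2 : (2 <= h)%N by near: h; exists 2%N.
have h0 : 0 < h%:R :> R by rewrite ltr0n; exact: leq_trans h2.
have h1 : 1 < h%:R :> R by rewrite ltr1n.
have lnh : ln 2 <= ln h%:R :> R by rewrite ler_ln ?posrE// ler_nat.
have lnh0 : 0 < ln h%:R :> R by rewrite ln_gt0.
have kC : C <= k by near: k; apply: nbhs_pinfty_ge; exact: num_real.
rewrite [X in _ <= _ * X]ger0_norm; last by rewrite divr_ge0 ?exprn_ge0 ?ltW.
have {}kC : C * (ln h%:R / h%:R ^+ 2) <= k * (ln h%:R / h%:R ^+ 2).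
  by rewrite ler_wpM2r// divr_ge0 ?exprn_ge0 ?ltW.
apply: le_trans kC.
have /andP[x0 x1] := critical_iteration_bounds h.
set y := (x h)^-1; have y0 : 0 < y by rewrite invr_gt0.
have -> : x h = y^-1 by rewrite invrK.
have yge : 1 + h%:R / 2 <= y := critical_inverse_ge h.
have yle : y <= (x 0%N)^-1 + h%:R / 2 + ln h.+1%:R := critical_inverse_le h.
have lnS : ln h.+1%:R <= 2 * ln h%:R :> R.
  rewrite mulr_natl -lnXn// ler_ln ?posrE ?exprn_gt0// -natrX ler_nat.
  by rewrite expnS expn1; nia.
have xl : (x 0%N)^-1 <= (x 0%N)^-1 / ln 2 * ln h%:R.
  have /andP[x00 _] := critical_iteration_bounds 0.
  by rewrite -mulrA ler_peMr ?invr_ge0 ?(ltW x00)// mulrC ler_pdivlMr// mul1r.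
have -> : y^-1 - 2 / h%:R = - ((y - h%:R / 2) * (2 / (h%:R * y))).
  by field; rewrite !gt_eqF.
have dy : 0 <= y - h%:R / 2 by move: yge; lra.
have hy : 0 <= 2 / (h%:R * y) by rewrite divr_ge0 ?mulr_ge0 ?(ltW h0) ?(ltW y0).
rewrite normrN ger0_norm; last exact: mulr_ge0.
have -> : C * (ln h%:R / h%:R ^+ 2) = (C / 4 * ln h%:R) * (4 / h%:R ^+ 2).
  by field; rewrite gt_eqF.
apply: ler_pM => //.
  by rewrite /C; move: yle lnS xl; lra.
rewrite ler_pdivrMr ?mulr_gt0// mulrAC ler_pdivlMr ?exprn_gt0//.
rewrite expr2; move: yge h0; nra.
Unshelve. all: by end_near. Qed.

End CriticalIteration.

(** * Weighted norms of power series *)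

Section PowerSeriesNorm.
Context {R : realType} (x0 e : R).
Hypothesis e_gt0 : 0 < e.

Let e0 : 0 <= e := ltW e_gt0.
Implicit Types (f g : R -> R) (N B c : R).

(* On the points [x >= 0] within [e] of [x0], [f] is the sum of a power series
   [a] whose norm, the sum of the [`|a k| * e ^+ k], is at most [N]. *)
Definition power_series_norm_le f N : Prop := exists a : nat -> R,
  (forall K, \sum_(k < K) `|a k| * e ^+ k <= N) /\
  forall x, 0 <= x -> `|x - x0| <= e -> pseries a (x - x0) @ \oo --> f x.

Local Notation PS := power_series_norm_le.

Lemma pseriesE (a : nat -> R) (y : R) :
  pseries a y = fun n => \sum_(k < n) a k * y ^+ k.
Proof. by apply/funext => n; rewrite /pseries /series /= big_mkord. Qed.

Lemma psnorm_ge0 f N : PS f N -> 0 <= N.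
Proof. by move=> [a [/(_ 0%N) + _]]; rewrite big_ord0. Qed.

Lemma psnorm_widen f N B : N <= B -> PS f N -> PS f B.
Proof. by move=> NB [a [aN af]]; exists a; split=> // K; exact: le_trans NB. Qed.

Lemma psnorm_ext f g N : (forall x, 0 <= x -> f x = g x) -> PS f N -> PS g N.
Proof. by move=> fg [a [aN af]]; exists a; split=> // x xp xe; rewrite -fg//; exact: af. Qed.

Lemma psnorm_cst c : PS (fun=> c) `|c|.
Proof.
exists (fun k => if k is 0%N then c else 0).
split=> [[|K]|x xp xe].
- by rewrite big_ord0.
- by rewrite big_ord_recl expr0 mulr1 big1 ?addr0// => i _; rewrite normr0 mul0r.
- rewrite pseriesE; apply: cvg_near_cst; exists 1%N => // -[|K] // _.
  by rewrite big_ord_recl expr0 mulr1 big1 ?addr0// => i _; rewrite mul0r.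
Qed.

Lemma psnormZ c f N : PS f N -> PS (fun x => c * f x) (`|c| * N).
Proof.
move=> [a [aN af]]; exists (fun k => c * a k); split=> [K|x xp xe].
  under eq_bigr do rewrite normrM -mulrA.
  by rewrite -mulr_sumr ler_wpM2l.
have := af x xp xe; rewrite !pseriesE => h.
under eq_fun do under eq_bigr do rewrite -mulrA.
under eq_fun do rewrite -mulr_sumr.
by apply: cvgM h; exact: cvg_cst.
Qed.

Lemma psnormD f g N B : PS f N -> PS g B -> PS (fun x => f x + g x) (N + B).
Proof.
move=> [a [aN af]] [b [bB bg]]; exists (fun k => a k + b k); split=> [K|x xp xe].
  apply: le_trans (lerD (aN K) (bB K)); rewrite -big_split/=; apply: ler_sum => i _.
  by rewrite -mulrDl ler_wpM2r ?exprn_ge0// ler_normD.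
have := af x xp xe; have := bg x xp xe; rewrite !pseriesE => hg hf.
under eq_fun do under eq_bigr do rewrite mulrDl.
under eq_fun do rewrite big_split/=.
exact: cvgD.
Qed.

Lemma psnorm_shift f N : PS f N -> PS (fun x => (x - x0) * f x) (e * N).
Proof.
move=> [a [aN af]]; exists (fun k => if k is k'.+1 then a k' else 0).
split=> [[|K]|x xp xe].
- by rewrite big_ord0 mulr_ge0//; apply: psnorm_ge0 (ex_intro _ a (conj aN af)).
- rewrite big_ord_recl normr0 mul0r add0r /=.
  under eq_bigr do rewrite /bump /= exprS mulrCA.
  by rewrite -mulr_sumr ler_wpM2l//; exact: aN.
have := af x xp xe; rewrite !pseriesE => h.
have e1 : (fun n => \sum_(k < n.+1) (if nat_of_ord k is k'.+1 then a k' else 0) * (x - x0) ^+ k) =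
    fun n => (x - x0) * \sum_(k < n) a k * (x - x0) ^+ k.
  apply/funext => n; rewrite big_ord_recl mul0r add0r mulr_sumr.
  by apply: eq_bigr => k _; rewrite lift0 exprS mulrCA.
rewrite -cvg_shiftS e1.
by apply: cvgM h; exact: cvg_cst.
Qed.

(** Completeness of the weighted l^1 norm: the coefficients are summed separately, and the resulting
    series is identified with [F] by approximation with finite partial sums. *)
Lemma psnorm_series (f : nat -> R -> R) (N : nat -> R) F B :
  (forall n, PS (f n) (N n)) -> (forall M, \sum_(n < M) N n <= B) ->
  (forall x, 0 <= x -> `|x - x0| <= e -> \sum_(n < M) f n x @[M --> \oo] --> F x) ->
  PS F B.
Proof.
move=> fN NB fF.
have N0 n : 0 <= N n by exact: psnorm_ge0 (fN n).
have [A hA] := choice fN.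
pose S M : R := \sum_(n < M) N n.
have ndS : nondecreasing_seq S.
  by apply/nondecreasing_seqP => n; rewrite /S big_ord_recr lerDl.
have cS : cvgn S.
  by apply: nondecreasing_is_cvgn => //; exists B => _ [n _ <-]; exact: NB.
pose Sinf := limn S.
have SB : Sinf <= B by apply: limr_le => //; apply: nearW => n; exact: NB.
have SS n : S n <= Sinf by exact: nondecreasing_cvgn_le.
have AN n k : `|A n k| * e ^+ k <= N n.
  have [/(_ k.+1) + _] := hA n; rewrite big_ord_recr /=; apply: le_trans.
  by rewrite lerDr sumr_ge0// => i _; rewrite mulr_ge0// exprn_ge0.
have cA k : cvgn (fun M => \sum_(n < M) A n k).
  have -> : (fun M => \sum_(n < M) A n k) = series (fun n => A n k) by rewrite seriesEord.
  apply: normed_cvg; rewrite /normed_series_of seriesEord.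
  apply: nondecreasing_is_cvgn.
    by apply/nondecreasing_seqP => n; rewrite /= big_ord_recr lerDl.
  exists (Sinf / e ^+ k) => _ [M _ <-]; rewrite ler_pdivlMr ?exprn_gt0//.
  apply: le_trans (SS M); rewrite mulr_suml.
  by apply: ler_sum => n _; exact: AN.
pose a k := limn (fun M => \sum_(n < M) A n k).
(* The remainder after [M] functions, in the norm, is at most the tail of the series of norms,
   uniformly in the truncation [K]. *)
have key K M : \sum_(k < K) `|a k - \sum_(n < M) A n k| * e ^+ k <= Sinf - S M.
  have lim : (fun M' => \sum_(k < K) `|\sum_(n < M') A n k - \sum_(n < M) A n k| * e ^+ k)
      @ \oo --> \sum_(k < K) `|a k - \sum_(n < M) A n k| * e ^+ k.
    apply: cvg_sumr => k; apply: cvgM (cvg_cst _); apply: cvg_norm.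
    by apply: cvgB (cvg_cst _); exact: cA.
  apply: (cvgr_to_le lim); exists M => // M' /= MM'.
  apply: (@le_trans _ _ (S M' - S M)); last by rewrite lerD2r.
  have -> : S M' - S M = \sum_(M <= n < M') N n.
    by rewrite /S -!(big_mkord xpredT N) (big_cat_nat _ MM')//= addrAC subrr add0r.
  apply: (@le_trans _ _ (\sum_(k < K) \sum_(M <= n < M') `|A n k| * e ^+ k)).
    apply: ler_sum => k _; rewrite -mulr_suml ler_wpM2r ?exprn_ge0//.
    rewrite -!(big_mkord xpredT (fun n => A n k)) (big_cat_nat _ MM')//= addrAC subrr add0r.
    exact: ler_norm_sum.
  rewrite exchange_big /=; apply: ler_sum => n _.
  by have [/(_ K)] := hA n.
exists a; split=> [K|x xp xe].
  apply: le_trans SB; have := key K 0%N; rewrite /S big_ord0 subr0; apply: le_trans.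
  by apply: ler_sum => k _; rewrite big_ord0 subr0.
apply/cvgrPdist_lt => d d0.
have d3 : 0 < d / 3 by rewrite divr_gt0.
have /cvgrPdist_lt /(_ _ d3) [M0 _ hM0] := fF x xp xe.
have cS' : S @ \oo --> Sinf by [].
have /cvgrPdist_lt /(_ _ d3) [M1 _ hM1] := cS'.
pose M := maxn M0 M1.
have h1 := hM0 M (leq_maxl _ _); have h2 := hM1 M (leq_maxr _ _).
have lim : (fun K => \sum_(k < K) (\sum_(n < M) A n k) * (x - x0) ^+ k) @ \oo -->
    \sum_(n < M) f n x.
  have -> : (fun K => \sum_(k < K) (\sum_(n < M) A n k) * (x - x0) ^+ k) =
      fun K => \sum_(n < M) \sum_(k < K) A n k * (x - x0) ^+ k.
    apply/funext => K; rewrite exchange_big /=.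
    by apply: eq_bigr => k _; rewrite mulr_suml.
  apply: cvg_sumr => n; have [_ /(_ x xp xe)] := hA n; by rewrite pseriesE.
have /cvgrPdist_lt /(_ _ d3) [K0 _ hK0] := lim.
exists K0 => // K /= K0K; have h3 := hK0 K K0K.
rewrite pseriesE.
have h4 : `|\sum_(k < K) (\sum_(n < M) A n k) * (x - x0) ^+ k -
    \sum_(k < K) a k * (x - x0) ^+ k| < d / 3.
  move: h2; rewrite /= ger0_norm ?subr_ge0// => /(le_lt_trans _); apply; rewrite -sumrB.
  apply: le_trans (key K M); apply: le_trans (ler_norm_sum _ _ _) _.
  apply: ler_sum => k _; rewrite -mulrBl normrM distrC ler_wpM2l// normrX.
  by rewrite lerXn2r// nnegrE.
rewrite (_ : F x - _ = (F x - \sum_(n < M) f n x) +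
  (\sum_(n < M) f n x - \sum_(k < K) (\sum_(n < M) A n k) * (x - x0) ^+ k) +
  (\sum_(k < K) (\sum_(n < M) A n k) * (x - x0) ^+ k - \sum_(k < K) a k * (x - x0) ^+ k));
  last by ring.
apply: le_lt_trans (ler_normD _ _) _; rewrite (_ : d = d / 3 + d / 3 + d / 3); last by field.
apply: ltrD => //; apply: le_lt_trans (ler_normD _ _) _; exact: ltrD.
Qed.

Lemma psnormX k f N : PS f N -> PS (fun x => (x - x0) ^+ k * f x) (e ^+ k * N).
Proof.
move=> fN; elim: k => [|k ih].
  by rewrite expr0 mul1r; apply: psnorm_ext fN => x _; rewrite expr0 mul1r.
rewrite exprS -mulrA; apply: psnorm_ext (psnorm_shift _ _ ih) => x _.
by rewrite exprS mulrA.
Qed.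

(** Expanding only [f] writes the product as a series of functions [a k * (x - x0) ^+ k * g x],
    which replaces the Cauchy product. *)
Lemma psnormM f g N B : PS f N -> PS g B -> PS (fun x => f x * g x) (N * B).
Proof.
move=> [a [aN af]] gB.
apply: (@psnorm_series (fun k x => a k * ((x - x0) ^+ k * g x)) (fun k => `|a k| * (e ^+ k * B))).
- by move=> k; apply: psnormZ; exact: psnormX.
- move=> M; under eq_bigr do rewrite mulrA.
  by rewrite -mulr_suml ler_wpM2r// (psnorm_ge0 _ _ gB).
- move=> x xp xe; under eq_fun do under eq_bigr do rewrite mulrA.
  under eq_fun do rewrite -mulr_suml.
  by apply: cvgM (cvg_cst _); have := af x xp xe; rewrite pseriesE.
Qed.

Lemma psnorm_exprn k f N : PS f N -> PS (fun x => f x ^+ k) (N ^+ k).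
Proof.
move=> fN; elim: k => [|k ih].
  by rewrite expr0; apply: psnorm_widen (psnorm_cst 1); rewrite normr1.
by rewrite exprS; apply: psnorm_ext (psnormM _ _ _ _ fN ih) => x _; rewrite exprS.
Qed.

Lemma expR_series_cvg (x : R) : (fun n => \sum_(k < n) (k`!%:R)^-1 * x ^+ k) @ \oo --> expR x.
Proof.
have := @is_cvg_series_exp_coeff R x; rewrite /expR exp_coeffE seriesEord.
exact.
Qed.

(* The Taylor remainders of the exponential have nonnegative coefficients. *)
Lemma psnorm_expR (j : nat) f N : PS f N ->
  PS (fun x => expR (f x) - \sum_(k < j) (k`!%:R)^-1 * f x ^+ k)
     (expR N - \sum_(k < j) (k`!%:R)^-1 * N ^+ k).
Proof.
move=> fN; have N0 := psnorm_ge0 _ _ fN.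
have shift (y : R) M : \sum_(n < M) ((j + n)`!%:R)^-1 * y ^+ (j + n) =
    \sum_(n < j + M) (n`!%:R)^-1 * y ^+ n - \sum_(k < j) (k`!%:R)^-1 * y ^+ k.
  by rewrite big_split_ord /= addrAC subrr add0r.
have lim (y : R) : \sum_(n < M) ((j + n)`!%:R)^-1 * y ^+ (j + n) @[M --> \oo] -->
    expR y - \sum_(k < j) (k`!%:R)^-1 * y ^+ k.
  under eq_fun do rewrite shift.
  apply: cvgB (cvg_cst _); under eq_fun do rewrite addnC.
  have := expR_series_cvg y; rewrite -(cvg_shiftn j).
  exact.
apply: (@psnorm_series (fun n x => ((j + n)`!%:R)^-1 * f x ^+ (j + n))
    (fun n => ((j + n)`!%:R)^-1 * N ^+ (j + n))).
- move=> n; apply: psnorm_widen (psnormZ _ _ _ (psnorm_exprn (j + n) _ _ fN)).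
  by rewrite ger0_norm ?invr_ge0.
- move=> M; apply: (cvgr_to_ge (lim N)); exists M => // M' /= MM'.
  rewrite -(subnKC MM') big_split_ord /= lerDl sumr_ge0// => i _.
  by rewrite mulr_ge0 ?invr_ge0 ?exprn_ge0.
- by move=> x xp xe; exact: lim.
Qed.

End PowerSeriesNorm.

(** * The Koenigs function *)

Section Koenigs.
Context {R : realType} (r : R).
Hypotheses (r0 : 0 < r) (r1 : r < 1).

Definition height_map (x : R) : R := 1 - expR (- (r * x)).
Local Notation phi := height_map.

Definition koenigs_seq (x : R) (n : nat) : R := iter n phi x / r ^+ n.
Local Notation theta_ := koenigs_seq.

Definition koenigs (x : R) : R := limn (koenigs_seq x).
Local Notation theta := koenigs.

Lemma height_map_bounds x : 0 <= x -> 0 <= phi x <= r * x.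
Proof.
move=> x0; rewrite /height_map subr_ge0 -[in X in _ <= X](expR0 R) ler_expR oppr_le0.
rewrite mulr_ge0 ?(ltW r0)//= lerBlDr -lerBlDl; exact: expR_ge1Dx.
Qed.

Lemma iter_height_map_bounds x n : 0 <= x -> 0 <= iter n phi x <= r ^+ n * x.
Proof.
move=> x0; elim: n => [|n /andP[ih1 ih2]]; first by rewrite expr0 mul1r x0 lexx.
rewrite iterS; have /andP[-> /= h] := height_map_bounds _ ih1.
by apply: le_trans h _; rewrite exprS -mulrA ler_pM2l.
Qed.

Lemma iter_height_map_ge0 x n : 0 <= x -> 0 <= iter n phi x.
Proof. by move=> x0; have /andP[] := iter_height_map_bounds x n x0. Qed.

Let rn0 n : 0 < r ^+ n. Proof. exact: exprn_gt0. Qed.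

(** The quadratic error of [phi] at a point of size [r ^+ n * x], divided by [r ^+ n.+1], still
    decays geometrically. *)
Lemma koenigs_seq_step x n : 0 <= x ->
  0 <= theta_ x n - theta_ x n.+1 <= x ^+ 2 / 2 * r ^+ n.+1.
Proof.
move=> x0; have /andP[y0 yx] := iter_height_map_bounds x n x0.
rewrite /koenigs_seq iterS; set y := iter n phi x in y0 yx *.
have -> : y / r ^+ n - phi y / r ^+ n.+1 = (r * y - phi y) / r ^+ n.+1.
  by rewrite exprS; field; rewrite !gt_eqF.
have /andP[_ h1] := height_map_bounds _ y0.
rewrite divr_ge0 ?subr_ge0 ?(ltW (rn0 _))//= ler_pdivrMr//.
have h2 : r * y - phi y <= (r * y) ^+ 2 / 2.
  have := expR_upper_bound (r * y); rewrite mulr_ge0 ?(ltW r0)// => /(_ isT).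
  by rewrite /height_map; lra.
apply: le_trans h2 _.
apply: (@le_trans _ _ ((r * (r ^+ n * x)) ^+ 2 / 2)).
  rewrite ler_pM2r ?invr_gt0// lerXn2r// ?nnegrE ?mulr_ge0 ?(ltW r0)// ?(ltW (rn0 _))//.
  by rewrite ler_pM2l.
by rewrite mulrA -exprS exprMn expr2 le_eqVlt; apply/orP; left; apply/eqP; ring.
Qed.

Lemma koenigs_seq_nonincreasing x : 0 <= x -> nonincreasing_seq (theta_ x).
Proof.
move=> x0; apply/nonincreasing_seqP => n.
by have /andP[+ _] := koenigs_seq_step x n x0; rewrite subr_ge0.
Qed.

Lemma koenigs_seq_ge0 x n : 0 <= x -> 0 <= theta_ x n.
Proof. by move=> x0; rewrite divr_ge0 ?iter_height_map_ge0 ?(ltW (rn0 _)). Qed.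

Lemma koenigs_seq_cvg x : 0 <= x -> theta_ x @ \oo --> theta x.
Proof.
move=> x0; apply: nonincreasing_is_cvgn; first exact: koenigs_seq_nonincreasing.
by exists 0 => _ [n _ <-]; exact: koenigs_seq_ge0.
Qed.

Lemma koenigs_bounds x n : 0 <= x ->
  0 <= theta_ x n - theta x <= x ^+ 2 / 2 * (r ^+ n.+1 / (1 - r)).
Proof.
move=> x0; have c := koenigs_seq_cvg x x0; apply/andP; split.
  rewrite subr_ge0; apply: (nonincreasing_cvgn_ge (koenigs_seq_nonincreasing x x0)).
  exact: cvgP c.
(* Subtracting the remaining geometric sum turns the nonincreasing sequence into a nondecreasing
   one, which stays below the limit. *)
pose w m := theta_ x m - x ^+ 2 / 2 * (r ^+ m.+1 / (1 - r)).
have nd : nondecreasing_seq w.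
  apply/nondecreasing_seqP => m; rewrite /w.
  have /andP[_ h] := koenigs_seq_step x m x0.
  have : x ^+ 2 / 2 * r ^+ m.+1 = x ^+ 2 / 2 * (r ^+ m.+1 / (1 - r)) -
    x ^+ 2 / 2 * (r ^+ m.+2 / (1 - r)).
    rewrite [r ^+ m.+2]exprS; field; rewrite subr_eq0 eq_sym lt_eqF//.
  move: h; lra.
rewrite lerBlDr -lerBlDl; apply: (cvgr_to_ge c); exists n => // m /= nm.
apply: le_trans (nd _ _ nm) _; rewrite /w gerBl.
by rewrite !mulr_ge0 ?divr_ge0 ?exprn_ge0 ?invr_ge0 ?subr_ge0 ?(ltW r1) ?(ltW r0).
Qed.

Lemma koenigs_near0 x : 0 <= x -> 0 <= x - theta x <= x ^+ 2 * (r / (1 - r)).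
Proof.
move=> x0; have := koenigs_bounds x 0 x0; rewrite /koenigs_seq /= expr0 divr1 expr1.
move=> /andP[-> h] /=; apply: le_trans h _.
apply: ler_wpM2r; first by rewrite divr_ge0 ?subr_ge0 ?(ltW r0) ?(ltW r1).
by rewrite ler_piMr ?exprn_ge0// invf_le1// ler1n.
Qed.

Lemma koenigs_functional x : 0 <= x -> theta (phi x) = r * theta x.
Proof.
move=> x0; have /andP[p0 _] := height_map_bounds x x0.
apply: cvg_lim => //; have c := koenigs_seq_cvg x x0.
have -> : theta_ (phi x) = fun n => r * theta_ x n.+1.
  apply/funext => n; rewrite /koenigs_seq -iterSr exprS; field.
  by rewrite !gt_eqF.
apply: cvgM; first exact: cvg_cst.
by rewrite (cvg_shiftS (theta_ x)).
Qed.

Lemma koenigs_iter x n : 0 <= x -> theta (iter n phi x) = r ^+ n * theta x.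
Proof.
move=> x0; elim: n => [|n ih]; first by rewrite mul1r.
by rewrite iterS koenigs_functional ?iter_height_map_ge0// ih mulrA -exprS.
Qed.

Lemma koenigs0 : theta 0 = 0.
Proof.
have /andP[h1 h2] := koenigs_near0 0 (lexx _).
by apply/eqP; rewrite eq_le; move: h1 h2; rewrite expr0n /= mul0r; lra.
Qed.

Lemma iter_height_map_cvg0 x : 0 <= x -> iter n phi x @[n --> \oo] --> (0 : R).
Proof.
move=> x0; have lim : r ^+ n * x @[n --> \oo] --> (0 : R).
  rewrite -[X in _ --> X](mul0r x); apply: cvgM (cvg_cst _).
  by apply: cvg_expr; rewrite ger0_norm ?ltW.
apply: (squeeze_cvgr _ (cvg_cst 0) lim); apply: nearW => n.
exact: iter_height_map_bounds.
Qed.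

Lemma iter_height_map_gt0 x n : 0 < x -> 0 < iter n phi x.
Proof.
move=> x0; elim: n => // n ih; rewrite iterS /height_map subr_gt0 expR_lt1 oppr_lt0.
exact: mulr_gt0.
Qed.

(** Near [0], [theta y] is at least [y * (1 - y * (r / (1 - r)))], positive for [y < (1 - r) / r].
    Some iterate of [x] is that small, and the functional equation carries positivity back. *)
Lemma koenigs_gt0 x : 0 < x -> 0 < theta x.
Proof.
move=> x0; have x0' := ltW x0; pose d := (1 - r) / r.
have d0 : 0 < d by rewrite divr_gt0 ?subr_gt0.
have /cvgrPdist_lt /(_ _ d0) [n _ /(_ n (leqnn n))] := iter_height_map_cvg0 x x0'.
have y0 := iter_height_map_gt0 x n x0.
rewrite /= sub0r normrN gtr0_norm// => yd.
rewrite -(pmulr_rgt0 _ (rn0 n)) -koenigs_iter//.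
have /andP[_ h] := koenigs_near0 _ (ltW y0).
set y := iter n phi x in y0 yd h *.
apply: (@lt_le_trans _ _ (y - y ^+ 2 * (r / (1 - r)))); last by move: h; lra.
rewrite (_ : y - _ = y * (1 - y * (r / (1 - r)))); last by ring.
rewrite mulr_gt0// subr_gt0 -[r / _]invf_div -/d ltr_pdivrMr// mul1r.
exact: yd.
Qed.

Lemma koenigs_derivative0 : x^-1 * (theta x - theta 0) @[x --> 0^'+] --> (1 : R).
Proof.
rewrite koenigs0; pose k := r / (1 - r).
have lim : 1 - x * k @[x --> 0^'+] --> (1 : R).
  rewrite -[X in _ --> X]subr0 -[X in _ - X](mul0r k); apply: cvgB; first exact: cvg_cst.
  by apply: cvgM (cvg_cst _); exact: cvg_at_right_filter.
have lim1 : (fun _ : R => 1 : R) x @[x --> 0^'+] --> (1 : R) by exact: cvg_cst.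
apply: (squeeze_cvgr _ lim lim1); near=> x.
have x0 : 0 < x by [].
have /andP[h1 h2] := koenigs_near0 _ (ltW x0).
rewrite subr0 ler_pdivlMl// ler_pdivrMl// mulr1; apply/andP; split; last by move: h1; lra.
by rewrite mulrBr mulr1 mulrA -expr2; move: h2; rewrite /k; lra.
Unshelve. all: by end_near. Qed.

(** With [y] the [n]-th iterate of [x], [f x] equals [f y / y] times [koenigs_seq r x n] for every
    [n]; the first factor tends to the derivative at [0]. *)
Lemma schroeder_unique f : schroeder_solution r f -> forall x, 0 <= x -> f x = theta x.
Proof.
move=> [fE _ f1] x x0.
have f0 : f 0 = 0.
  have := fE 0 (lexx _); rewrite mulr0 oppr0 expR0 subrr => e.
  have : (1 - r) * f 0 = 0 by rewrite mulrBl mul1r -e subrr.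
  by move=> /eqP; rewrite mulf_eq0 subr_eq0 eq_sym lt_eqF//= => /eqP.
move: x0; rewrite le_eqVlt => /predU1P[<-|x0]; first by rewrite f0 koenigs0.
have fn n : f (iter n phi x) = r ^+ n * f x.
  elim: n => [|n ih]; first by rewrite mul1r.
  rewrite iterS /height_map fE ?iter_height_map_ge0 ?(ltW x0)// ih.
  by rewrite mulrA -exprS.
have lim1 : (iter n phi x)^-1 * f (iter n phi x) @[n --> \oo] --> (1 : R).
  move: f1; rewrite f0; under eq_fun do rewrite subr0; move=> f1.
  apply: (@cvg_comp _ _ _ (fun n => iter n phi x) (fun y => y^-1 * f y) _ _ _ _ f1).
  move=> A [d /= d0 hA]; have /cvgrPdist_lt /(_ _ d0) [n0 _ h] := iter_height_map_cvg0 x (ltW x0).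
  exists n0 => // n /= n0n; apply: hA; first exact: h.
  exact: iter_height_map_gt0.
have lim2 : (iter n phi x)^-1 * f (iter n phi x) * theta_ x n @[n --> \oo] --> 1 * theta x.
  by apply: cvgM lim1 _; exact: koenigs_seq_cvg (ltW x0).
have e : (fun n => (iter n phi x)^-1 * f (iter n phi x) * theta_ x n) = fun=> f x.
  apply/funext => n; rewrite fn /koenigs_seq; have := iter_height_map_gt0 x n x0 => h.
  by field; rewrite !gt_eqF.
move: lim2; rewrite e mul1r => lim2.
exact: (cvg_unique _ (cvg_cst (f x)) lim2).
Qed.

End Koenigs.

(** * Local power series of the Koenigs function *)

Section KoenigsAnalytic.
Context {R : realType} (r : R).
Hypotheses (r0 : 0 < r) (r1 : r < 1).
Local Notation phi := (height_map r).
Local Notation theta_ := (koenigs_seq r).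
Local Notation theta := (koenigs r).

Lemma expR_sub1_le (u : R) : 0 <= u -> u <= 1 -> expR u - 1 <= u + u ^+ 2.
Proof.
move=> u0 u1; have := expR_Pade_bound u u0.
rewrite mulrC -ler_pdivlMr; last by move: u1; lra.
move=> h; rewrite lerBlDr; apply: le_trans h _.
rewrite ler_pdivrMr; last by move: u1; lra.
rewrite -subr_ge0 (_ : _ - _ = u ^+ 2 * (1 - u)); last by ring.
by rewrite mulr_ge0 ?exprn_ge0 ?subr_ge0.
Qed.

Lemma expR_sub1_sub_le (u : R) : 0 <= u -> expR u - 1 - u <= u ^+ 2 * expR u.
Proof.
move=> u0; have h : expR u - 1 <= u * expR u.
  have : (1 - u) * expR u <= 1.
    by rewrite -ler_pdivlMr ?expR_gt0// mul1r -expRN; exact: expR_ge1Dx.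
  lra.
have := ler_wpM2l u0 h; have := h; rewrite expr2.
have := ler_wpM2l u0 (expR_ge1Dx u); lra.
Qed.

Section AtPoint.
Variables (x0 : R) (x0_ge0 : 0 <= x0).
(** The value for which the coefficient [1 - r - 4 * e] in [m_step] vanishes; it is the same for all
    centres [x0]. *)
Let e := (1 - r) / 4.
Let e_gt0 : 0 < e. Proof. by rewrite divr_gt0 ?subr_gt0. Qed.
Local Notation PS := (power_series_norm_le x0 e).

(* The weight [2 - r ^+ n] absorbs the quadratic term of the exponential. *)
Let m n := e * r ^+ n * (2 - r ^+ n).

Let rn n : 0 < r ^+ n <= 1.
Proof. by rewrite exprn_gt0// exprn_ile1// ltW. Qed.

Let m_bounds n : 0 <= m n <= 2 * e * r ^+ n.
Proof.
have /andP[h1 h2] := rn n; have er : 0 <= e * r ^+ n by rewrite mulr_ge0 ?ltW.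
by rewrite /m mulr_ge0 ?subr_ge0//=; nra.
Qed.

Let m_step n : expR (r * m n) - 1 <= m n.+1.
Proof.
have /andP[h1 h2] := rn n; have /andP[m0 m2] := m_bounds n.
have e4 : 4 * e = 1 - r by rewrite /e; field.
have m1 : m n <= 1 / 2.
  apply: le_trans m2 _; apply: (@le_trans _ _ (2 * e * 1)); last by move: e4 r0; lra.
  by rewrite ler_pM2l// mulr_gt0.
have rm0 : 0 <= r * m n by rewrite mulr_ge0 ?(ltW r0).
have rm1 : r * m n <= 1.
  by apply: (@le_trans _ _ (1 * m n)); [rewrite ler_wpM2r ?(ltW r1)|move: m1; lra].
apply: le_trans (expR_sub1_le _ rm0 rm1) _.
apply: (@le_trans _ _ (r * m n * (1 + m n))).
  rewrite (_ : r * m n + _ = r * m n * (1 + r * m n)); last by ring.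
  by rewrite ler_wpM2l// lerD2l ler_piMl ?(ltW r1).
apply: (@le_trans _ _ (r * m n * (1 + 2 * e * r ^+ n))).
  by rewrite ler_wpM2l// lerD2l.
rewrite {1}/m /m exprS; set q := r ^+ n in h1 h2 *.
rewrite -subr_ge0 (_ : _ - _ = e * r * q * (q * (1 - r - 4 * e) + 2 * e * q ^+ 2)); last by ring.
rewrite e4 subrr mulr0 add0r; move: (e) (ltW e_gt0) => e2 e20.
by rewrite !mulr_ge0 ?exprn_ge0 ?(ltW r0) ?(ltW h1).
Qed.

(** With [y] and [y0] the iterates of [x] and [x0], [phi y - phi y0] is [- expR (- (r * y0))] times
    [expR (- r * (y - y0)) - 1], whose norm is at most [expR (r * m n) - 1]; [m_step] closes the
    induction. *)
Lemma iter_height_map_power_series n :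
  PS (fun x => iter n phi x - iter n phi x0) (m n).
Proof.
elim: n => [|n ih].
  rewrite /m expr0 mulr1 (_ : 2 - 1 = 1) ?mulr1; last by ring.
  have := psnorm_shift _ _ e_gt0 _ _ (psnorm_cst x0 e 1); rewrite normr1 mulr1.
  by apply: psnorm_ext => x _; rewrite mulr1.
have h := psnorm_expR _ _ e_gt0 1 _ _ (psnormZ _ _ (- r) _ _ ih).
have {}h := psnormZ _ _ (- expR (- (r * iter n phi x0))) _ _ h.
apply: psnorm_ext (psnorm_widen _ _ _ _ _ _ h) => [x xp|].
  rewrite !iterS /height_map big_ord1 fact0 invr1 mul1r expr0.
  have -> : - r * (iter n phi x - iter n phi x0) =
    - (r * iter n phi x) + r * iter n phi x0 by ring.
  rewrite expRD [expR (- (r * iter n phi x0))]expRN; field.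
  by rewrite gt_eqF ?expR_gt0.
rewrite big_ord1 fact0 invr1 mul1r expr0 normrN normrN (ger0_norm (expR_ge0 _)) gtr0_norm//.
apply: le_trans (m_step n); rewrite ler_piMl//.
  rewrite subr_ge0 -[leLHS]expR0 ler_expR mulr_ge0 ?(ltW r0)//.
  by have /andP[] := m_bounds n.
rewrite -[leRHS]expR0 ler_expR oppr_le0 mulr_ge0 ?(ltW r0)//.
exact: iter_height_map_ge0.
Qed.

Let B := x0 + 2 * e.
Let B0 : 0 <= B. Proof. by rewrite addr_ge0// mulr_ge0// ltW. Qed.

(** The increment is a second order remainder of the exponential. The iterate has norm at most
    [B * r ^+ n], and its square outweighs the division by [r ^+ n.+1]. *)
Lemma koenigs_step_power_series n :
  PS (fun x => theta_ x n.+1 - theta_ x n) (B ^+ 2 * expR B * r ^+ n.+1).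
Proof.
have /andP[q0 q1] := rn n.
have hg : PS (fun x => iter n phi x) (B * r ^+ n).
  have := psnormD _ _ e_gt0 _ _ _ _ (psnorm_cst x0 e (iter n phi x0)) (iter_height_map_power_series n).
  move=> /(psnorm_widen _ _ _ _ (B * r ^+ n)) h; apply: psnorm_ext (h _) => [x _|].
    by rewrite addrC subrK.
  have /andP[y0 y1] := iter_height_map_bounds r r0 x0 n x0_ge0.
  have /andP[_ m2] := m_bounds n.
  by rewrite ger0_norm// /B mulrDl lerD// mulrC.
have h := psnorm_expR _ _ e_gt0 2 _ _ (psnormZ _ _ (- r) _ _ hg).
have {}h := psnormZ _ _ (- (r ^+ n.+1)^-1) _ _ h.
apply: psnorm_ext (psnorm_widen _ _ _ _ _ _ h) => [x xp|].
  rewrite /koenigs_seq iterS /height_map !big_ord_recr big_ord0 /= !fact0 !invr1.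
  rewrite expr0 expr1 !mulNr exprS; field.
  by rewrite !gt_eqF.
rewrite !big_ord_recr big_ord0 /= !fact0 !invr1 !mul1r expr0 expr1 add0r.
rewrite !normrN (gtr0_norm r0) ger0_norm ?invr_ge0 ?exprn_ge0 ?(ltW r0)//.
set u := r * (B * r ^+ n).
have u0 : 0 <= u by rewrite !mulr_ge0 ?(ltW r0) ?(ltW q0).
have uB : u <= B.
  rewrite /u mulrCA -exprS ler_piMr// exprn_ile1 ?(ltW r0) ?(ltW r1)//.
rewrite ler_pdivrMl ?exprn_gt0// opprD addrA.
apply: le_trans (expR_sub1_sub_le _ u0) _.
rewrite (_ : _ * (B ^+ 2 * _ * _) = u ^+ 2 * expR B); last by rewrite /u exprS; ring.
by rewrite ler_wpM2l ?exprn_ge0// ler_expR.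
Qed.

Lemma koenigs_power_series : exists N, PS theta N.
Proof.
(* The increments telescope from [koenigs_seq r x 0 = x]. *)
have h : PS (fun x => theta x - x) (B ^+ 2 * expR B * (r / (1 - r))).
  apply: (psnorm_series _ _ e_gt0 _ _ _ _ koenigs_step_power_series) => [M|x xp _].
    rewrite -mulr_sumr ler_wpM2l ?mulr_ge0 ?exprn_ge0 ?expR_ge0//.
    have -> : \sum_(n < M) r ^+ n.+1 = r * (1 - r ^+ M) / (1 - r).
      elim: M => [|M ih]; first by rewrite big_ord0 expr0 subrr mulr0 mul0r.
      rewrite big_ord_recr /= ih !exprS; field.
      by rewrite subr_eq0 eq_sym lt_eqF.
    rewrite ler_pM2r ?invr_gt0 ?subr_gt0// ler_piMr ?(ltW r0)// gerBl.
    by have /andP[/ltW] := rn M.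
  have e1 : (fun M => \sum_(n < M) (theta_ x n.+1 - theta_ x n)) = fun M => theta_ x M - x.
    apply/funext => M; elim: M => [|M ih].
      by rewrite big_ord0 /koenigs_seq expr0 divr1 subrr.
    by rewrite big_ord_recr /= ih; ring.
  rewrite e1; apply: cvgB (cvg_cst _); exact: koenigs_seq_cvg.
have hx := psnormD _ _ e_gt0 _ _ _ _ (psnorm_cst x0 e x0) (iter_height_map_power_series 0).
exists (B ^+ 2 * expR B * (r / (1 - r)) + (`|x0| + m 0)).
apply: psnorm_ext (psnormD _ _ e_gt0 _ _ _ _ h hx) => x _ /=; ring.
Qed.

End AtPoint.

Lemma koenigs_analytic : analytic_on_nonneg theta.
Proof.
move=> x0 x00; have [N [a [_ h]]] := koenigs_power_series x0 x00.
exists a, ((1 - r) / 4); split; first by rewrite divr_gt0 ?subr_gt0.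
by move=> x xp /ltW; exact: h.
Qed.

Lemma koenigs_schroeder : schroeder_solution r theta.
Proof.
split; [exact: koenigs_functional|exact: koenigs_analytic|exact: koenigs_derivative0].
Qed.

End KoenigsAnalytic.

(** * Conclusion in the subcritical and the critical case *)

Lemma critical_root {R : realType} (r : R) : r * expR (- r) = expR (- 1) -> r = 1.
Proof.
move=> er; apply/eqP; apply: contraT => r1.
have : 1 + (r - 1) < expR (r - 1) by apply: expR_gt1Dx; rewrite subr_eq0.
by rewrite expRD -er mulrCA -expRD subrr expR0 mulr1 addrC subrK ltxx.
Qed.

(* The constant [C] is chosen before the parameters, hence the bound in part 2
   is uniform in [r]. *)
Theorem theorem3p2 (R : realType) :
  exists (theta : R -> R -> R) (C : R),
  forall (lambda mu r : R)
    (d : measure_display) (T : measurableType d) (P : probability T R)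
    (G : R -> T -> tree)
    (d' : measure_display) (T' : measurableType d') (P' : probability T' R)
    (H : T' -> nat),
  0 < lambda -> 0 < mu ->
  lambda / mu <= expR (- 1) ->
  smallest_root (lambda / mu) r ->
  birth_death_tree_process P lambda mu G ->
  stationary_height P G P' H ->
  let tail (h : nat) : R := fine (P' [set w | (h < H w)%N]) in
  [/\ fine (P' [set w | H w = 0%N]) = expR (- r) /\
      (forall h : nat, tail h.+1 = 1 - expR (- (r * tail h))),
      lambda / mu < expR (- 1) ->
      [/\ schroeder_solution r (theta r),
          (forall f : R -> R, schroeder_solution r f ->
             forall x, 0 <= x -> f x = theta r x),
          0 < theta r 1
        & forall h : nat,
            `|tail h - theta r 1 * r ^+ h.+1| <= C * (r ^+ (2 * h) / (1 - r))]
    & lambda / mu = expR (- 1) ->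
      (fun h : nat => tail h - 2 / h%:R : R^o) =O_\oo
      (fun h : nat => ln h%:R / h%:R ^+ 2 : R^o)].
Proof.
(* [C = 1] works because [koenigs_bounds] leaves the factor [r ^+ 3 / 2], at most [1], in front of
   [r ^+ (2 * h) / (1 - r)]. *)
exists koenigs, 1 => lambda mu r d T P G d' T' P' H lambda0 mu0 rho1 rP.
move=> [p [tp rp mG]] [mH HG] tail.
pose l h := fine (P' [set w | (H w <= h)%N]).
have lE h : l h = \sum_(k < h.+1) fine (P' [set w | H w = k]) := nat_law_le _ _ P' H h mH.
have Vl h : forest_cdf p h [::] t @[t --> +oo] --> l h.
  rewrite lE; apply: (@cvg_trans _
    ((fun t => \sum_(k < h.+1) fine (P [set w | height (G t w) = k])) @ +oo)).
    apply: near_eq_cvg; near=> t; have t0 : 0 <= t by near: t; exact: nbhs_pinfty_ge.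
    by rewrite (forest_cdf_process _ _ P G p tp mG).
  apply: cvg_sumr => k; apply: fine_cvg; rewrite fineK ?fin_num_measure//.
have [l0 lS] := stationary_cdf lambda mu p lambda0 mu0 tp rp r rP l Vl.
have tailE h : tail h = 1 - l h by exact: nat_tail.
have r0 : 0 < r := smallest_root_gt0 lambda mu lambda0 mu0 r rP.
have tailS h : tail h.+1 = 1 - expR (- (r * tail h)) by rewrite !tailE lS.
have [r1 er _] := rP.
split.
- by split=> //; rewrite -l0 lE big_ord_recl big_ord0 addr0.
- move=> rho.
  have {}r1 : r < 1.
    rewrite lt_neqAle r1 andbT; apply: contraTneq rho => rE.
    by rewrite -er rE mul1r ltxx.
  (* The iteration starts one step earlier, from the value [1] of the tail at [-1]; hence the
     exponent [h.+1] in the expansion. *)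
  have iterE h : tail h = iter h.+1 (height_map r) 1.
    elim: h => [|h ih]; first by rewrite tailE l0 /= /height_map mulr1.
    by rewrite tailS ih.
  split; [exact: koenigs_schroeder|exact: schroeder_unique|exact: koenigs_gt0|move=> h].
  have /andP[b0 b1] := koenigs_bounds r r0 r1 1 h.+1 ler01.
  have rn0 : 0 < r ^+ h.+1 by rewrite exprn_gt0.
  have -> : tail h - koenigs r 1 * r ^+ h.+1 =
      r ^+ h.+1 * (koenigs_seq r 1 h.+1 - koenigs r 1).
    by rewrite iterE /koenigs_seq; field; rewrite gt_eqF.
  rewrite normrM (gtr0_norm rn0) (ger0_norm b0) mul1r.
  apply: (@le_trans _ _ (r ^+ h.+1 * (1 ^+ 2 / 2 * (r ^+ h.+2 / (1 - r))))).
    by rewrite ler_pM2l.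
  have -> : r ^+ h.+1 * (1 ^+ 2 / 2 * (r ^+ h.+2 / (1 - r))) =
      r ^+ (2 * h) / (1 - r) * (r ^+ 3 / 2).
    rewrite mul2n -addnn exprD !exprS; field.
    by rewrite subr_eq0 eq_sym lt_eqF.
  rewrite ler_piMr ?divr_ge0 ?exprn_ge0 ?subr_ge0 ?(ltW r0) ?(ltW r1)//.
  rewrite ler_pdivrMr// mul1r; apply: (@le_trans _ _ 1); last by rewrite ler1n.
  by rewrite exprn_ile1 ?(ltW r0) ?(ltW r1).
- move=> rho; have rE : r = 1 by apply: critical_root; rewrite er.
  apply: critical_iteration_asymptotics.
  + by rewrite tailE l0 rE.
  + by move=> h; rewrite tailS rE mul1r.
Unshelve. all: by end_near. Qed.
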